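(* Let $n\ge1$ and let $q\in k^\times$ be a primitive $\ell$-th root of unity with $\ell$ odd. For $\alpha,\beta\in\Lambda_+^{\le\kappa}$, the irreducible $D(\bar{\mathscr A}_q(n))$-module $\bar{\mathscr A}_{\alpha,\beta}$ is self-dual if and only if there exists a unique tuple $r=(r_1,\dots,r_n)\in\Lambda_+^{\le\kappa}$ such that $$\beta=[(i_0r_1,\dots,i_0r_n)],\qquad \alpha=[-\tilde\beta],$$ where $i_0=(\ell+1)/2$. In particular, if this is the case, then $\dim(\bar{\mathscr A}_{\alpha,\beta})=(r_1+1)\cdots(r_n+1)$, as $\kappa(\alpha,\beta)=r$, and any self-dual irreducible module is uniquely determined by this tuple $\kappa(\alpha,\beta)\in\Lambda_+^{\le\kappa}$.
   Context: Throughout, $k$ is an algebraically closed field of characteristic $0$. **Lattice notation.** $\Lambda=\bigoplus_{i=1}^n\mathbb Z\epsilon_i$ is the free abelian group with standard basis $\epsilon_1,\dots,\epsilon_n$. For $\alpha,\beta\in\Lambda$: $\alpha*\beta=\sum_{j=1}^{n-1}\sum_{i>j}\alpha_i\beta_j$, $\theta(\alpha,\beta)=q^{\alpha*\beta-\beta*\alpha}$, $\langle\alpha,\beta\rangle=\sum_i\alpha_i\beta_i$. Put $\kappa=(\ell-1,\dots,\ell-1)$ and $\Lambda_+^{\le\kappa}=\{\alpha\in\Lambda: 0\le\alpha_i\le \ell-1\text{ for all }i\}$. For $\beta\in\Lambda$, $\tilde\beta\in\Lambda$ has components $\tilde\beta_i=\beta_1+\cdots+\beta_i-\beta_{i+1}-\cdots-\beta_n$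 $(1\le i\le n)$. For $\alpha\in\Lambda$, $[\alpha]\in\Lambda_+^{\le\kappa}$ is the unique element congruent to $\alpha$ componentwise modulo $\ell$. For $\alpha,\beta\in\Lambda_+^{\le\kappa}$, $\kappa(\alpha,\beta):=[-\tilde\beta+2\beta-\alpha]$. **The $n$-rank Taft algebra.** $\bar{\mathscr A}_q(n)$ is the $k$-algebra generated by $K(\epsilon_i)^{\pm1},x_i$ ($1\le i\le n$) with relations: the $K(\epsilon_i)$ commute and are invertible; $K(\epsilon_i)^\ell=1$; $K(\epsilon_i)x_jK(\epsilon_i)^{-1}=\theta(\epsilon_i,\epsilon_j)q^{\delta_{ij}}x_j$; $x_ix_j=\theta(\epsilon_i,\epsilon_j)x_jx_i$; $x_i^\ell=0$. Write $K(\alpha)=\prod_iK(\epsilon_i)^{\alpha_i}$ and $x^\gamma=x_1^{\gamma_1}\cdots x_n^{\gamma_n}$. It is a Hopf algebra with $\Delta(K(\epsilon_i)^{\pm1})=K(\epsilon_i)^{\pm1}\otimes K(\epsilon_i)^{\pm1}$, $\Delta(x_i)=x_i\otimes1+K(\epsilon_i)\otimes x_i$, $\varepsilon(K(\epsilon_i)^{\pm1})=1$, $\varepsilon(x_i)=0$, $s(K(\epsilon_i)^{\pm1})=K(\epsilon_i)^{\mp1}$, $s(x_i)=-K(\epsilon_i)^{-1}x_i$, and $k$-basis $\{x^\gamma K(\alpha):\alpha,\gamma\in\Lambda_+^{\le\kappa}\}$. For $\alpha\in\Lambda$, $\mathcal K(\alpha)\in\bar{\mathscr A}_q(n)^*$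 is the group-like element with $\mathcal K(\alpha)(x^\gamma K(\beta))=\delta_{\gamma,0}q^{\langle\alpha,\beta\rangle}$. **Drinfel'd double.** For a finite-dimensional Hopf algebra $H$ with antipode $s$, $D(H)=(H^* )^{\mathrm{cop}}\bowtie H$ is $H^*\otimes H$ with multiplication $(p\otimes h)(p'\otimes h')=p\big(h_{(1)}\rightharpoonup p'\leftharpoonup s^{-1}(h_{(3)})\big)\otimes h_{(2)}h'$, where $h\rightharpoonup p=p_{(2)}(h)p_{(1)}$, $p\leftharpoonup h=p_{(1)}(h)p_{(2)}$, and the coalgebra structure of $(H^* )^{\mathrm{cop}}\otimes H$. A Yetter–Drinfel'd $H$-module is a left $H$-module and right $H$-comodule $M$ with $h_{(1)}\cdot m_{(0)}\otimes h_{(2)}m_{(1)}=(h_{(2)}\cdot m)_{(0)}\otimes(h_{(2)}\cdot m)_{(1)}h_{(1)}$; it is a left $D(H)$-module via $(p\otimes h)\cdot m=p\cdot(h\cdot m)$ with $p\cdot m=p(m_{(1)})m_{(0)}$. **The modules $\bar{\mathscr A}_{\alpha,\beta}$.** For $H=\bar{\mathscr A}_q(n)$ and $\alpha\in\Lambda_+^{\le\kappa}$, $H$ is a Yetter–Drinfel'd module with coaction $\Delta$ and action $h\bullet_{\mathcal K(\alpha)}a=(h_{(2)}\leftharpoonup\mathcal K(\alpha))\,a\,s^{-1}(h_{(1)})$, where $h\leftharpoonup\chi=\chi(h_{(1)})h_{(2)}$. For $\beta\in\Lambda_+^{\le\kappa}$, $\bar{\mathscr A}_{\alpha,\beta}:=H\bullet_{\mathcal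 K(\alpha)}K(\beta)$ is a simple Yetter–Drinfel'd submodule, hence a simple left $D(H)$-module. A finite-dimensional module $M$ is self-dual if $M\cong M^*$ as modules. *)

(* Defs.v *)
From HB Require Import structures.
From mathcomp Require Import all_boot all_order all_algebra all_field.

Set Implicit Arguments.
Unset Strict Implicit.
Unset Printing Implicit Defensive.

Import GRing.Theory VectorInternalTheory.
Local Open Scope ring_scope.

(* Tensor products of finite-dimensional spaces: U (x) V is the space of      *)
(* coordinate matrices with respect to the canonical bases (bvec i) of U and  *)
(* V.  [sweedler t B] is the value at t of the linear map on U (x) V induced  *)
(* by a bilinear B, so that for t = \sum u (x) v it is \sum B u v; with       *)
(* t = comul h, [sweedler t (fun h1 h2 => E)] is E in Sweedler notation.      *)

Definition tensor (k : fieldType) (U V : vectType k) := 'M[k]_(dim U, dim V).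

HB.instance Definition _ (k : fieldType) (U V : vectType k) :=
  Vector.copy (tensor U V) 'M[k]_(dim U, dim V).

Section Tensor.
Variable k : fieldType.

Definition bvec (U : vectType k) (i : 'I_(dim U)) : U := r2v (delta_mx 0 i).

Definition bcovec (U : vectType k) (i : 'I_(dim U)) : 'Hom(U, k^o) :=
  linfun (fun u => v2r u 0 i : k^o).

Definition tens (U V : vectType k) (u : U) (v : V) : tensor U V :=
  (v2r u)^T *m v2r v.

Definition sweedler (U V : vectType k) (W : lmodType k)
    (t : tensor U V) (B : U -> V -> W) : W :=
  \sum_(i < dim U) \sum_(j < dim V) t i j *: B (bvec i) (bvec j).

Lemma sweedler_tens (U V : vectType k) (W : lmodType k) (B : U -> V -> W) u v :
    (forall v, linear (B^~ v)) -> (forall u, linear (B u)) ->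
  sweedler (tens u v) B = B u v.
Proof.
move=> Bl Br.
have expand (X : vectType k) (f : X -> W) x : linear f ->
    f x = \sum_(i < dim X) v2r x 0 i *: f (bvec i).
  move=> fL; pose fm := GRing.isLinear.Build k X W _ f fL.
  pose g : {linear X -> W} := HB.pack f fm.
  rewrite -[f]/(g : X -> W) -[x in LHS]v2rK {1}[v2r x]row_sum_delta !linear_sum.
  by apply: eq_bigr => i _; rewrite !linearZ.
rewrite (expand _ _ u (Bl v)); apply: eq_bigr => i _.
rewrite (expand _ _ v (Br _)) scaler_sumr; apply: eq_bigr => j _.
by rewrite scalerA /tens mxE big_ord1 mxE.
Qed.

End Tensor.

Notation "u (x) v" := (tens u v) (at level 40, left associativity) : ring_scope.

Definition tens_mul (k : fieldType) (H : falgType k) (t t' : tensor H H) :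
    tensor H H :=
  sweedler t (fun a b => sweedler t' (fun c d => (a * c) (x) (b * d))).

HB.mixin Record Falgebra_isHopf (k : fieldType) H of Falgebra k H := {
  comul : 'Hom(H, tensor H H);
  counit : 'Hom(H, k^o);
  antipode : 'End(H);
  comulA : forall h : H,
    sweedler (comul h)
      (fun a b => sweedler (comul a) (fun a1 a2 => a1 (x) (a2 (x) b))) =
    sweedler (comul h) (fun a b => a (x) (comul b));
  counitl : forall h : H, sweedler (comul h) (fun a b => counit a *: b) = h;
  counitr : forall h : H, sweedler (comul h) (fun a b => counit b *: a) = h;
  comul1 : comul 1 = 1 (x) 1;
  comulM : forall g h : H, comul (g * h) = tens_mul (comul g) (comul h);
  counit1 : counit 1 = 1;
  counitM : forall g h : H, counit (g * h) = counit g * counit h;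
  antipodel : forall h : H,
    sweedler (comul h) (fun a b => antipode a * b) = (counit h : k)%:A;
  antipoder : forall h : H,
    sweedler (comul h) (fun a b => a * antipode b) = (counit h : k)%:A
}.

#[short(type="hopfAlgType")]
HB.structure Definition HopfAlgebra (k : fieldType) :=
  { H of Falgebra k H & Falgebra_isHopf k H }.

Section DrinfeldDouble.
Variables (k : fieldType) (H : hopfAlgType k).

Definition antipodeV : 'End(H) := (antipode^-1)%VF.

Definition hdual := 'Hom(H, k^o).

Definition hdual_mul (p p' : hdual) : hdual :=
  linfun (fun h => sweedler (comul h) (fun h1 h2 => p h1 * p' h2 : k^o)).

(* The coproduct of the dual, p (g * h) = \sum p1 g * p2 h. *)
Definition hdual_comul (p : hdual) : tensor hdual hdual :=
  \sum_(i < dim H) \sum_(j < dim H)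
     (p (bvec i * bvec j) : k) *: (bcovec i (x) bcovec j).

Definition hitl (h : H) (p : hdual) : hdual :=
  sweedler (hdual_comul p) (fun p1 p2 => (p2 h : k) *: p1).

Definition hitr (p : hdual) (h : H) : hdual :=
  sweedler (hdual_comul p) (fun p1 p2 => (p1 h : k) *: p2).

(* The underlying space H^* (x) H of D(H). *)
Definition drinfeld_double := tensor hdual H.

Definition double_one : drinfeld_double := (counit : hdual) (x) (1 : H).

Definition double_mul (t t' : drinfeld_double) : drinfeld_double :=
  sweedler t (fun p h => sweedler t' (fun p' h' =>
    sweedler (comul h) (fun h12 h3 => sweedler (comul h12) (fun h1 h2 =>
      hdual_mul p (hitr (hitl h1 p') (antipodeV h3)) (x) (h2 * h'))))).

(* The antipode of (H^* )^cop is p |-> p \o s^-1, and that of D(H) is the     *)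
(* anti-multiplicative map extending it and the antipode of H.                *)
Definition double_antipode (t : drinfeld_double) : drinfeld_double :=
  sweedler t (fun p h =>
    double_mul ((counit : hdual) (x) antipode h)
               (((p \o antipodeV)%VF : hdual) (x) (1 : H))).

Definition is_double_module (M : vectType k)
    (act : drinfeld_double -> M -> M) : Prop :=
  [/\ forall (c : k) d d' m, act (c *: d + d') m = c *: act d m + act d' m,
      forall (c : k) d m m', act d (c *: m + m') = c *: act d m + act d m',
      forall m, act double_one m = m
    & forall d d' m, act (double_mul d d') m = act d (act d' m)].

Definition double_submodule (M : vectType k)
    (act : drinfeld_double -> M -> M) (W : {vspace M}) : Prop :=
  forall d w, w \in W -> act d w \in W.

Definition is_irreducible (M : vectType k)
    (act : drinfeld_double -> M -> M) : Prop :=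
  (exists m : M, m != 0) /\
  forall W : {vspace M}, double_submodule act W -> W = 0%VS \/ W = fullv.

Definition double_iso (M N : vectType k)
    (actM : drinfeld_double -> M -> M)
    (actN : drinfeld_double -> N -> N) : Prop :=
  exists2 f : 'Hom(M, N), bijective f
    & forall d m, f (actM d m) = actN d (f m).

Definition dual_act (M : vectType k) (act : drinfeld_double -> M -> M)
    (d : drinfeld_double) (f : 'Hom(M, k^o)) : 'Hom(M, k^o) :=
  linfun (fun m => f (act (double_antipode d) m)).

Definition self_dual (M : vectType k)
    (act : drinfeld_double -> M -> M) : Prop :=
  double_iso act (dual_act act).

(* The action of D(H) on a Yetter-Drinfel'd module:                           *)
(* (p (x) h) . m = p (m'(1)) m'(0) for m' = h . m.                            *)
Definition yd_double_act (M : vectType k) (act : H -> M -> M)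
    (coact : M -> tensor M H) (d : drinfeld_double) (m : M) : M :=
  sweedler d (fun p h =>
    sweedler (coact (act h m)) (fun m0 m1 => (p m1 : k) *: m0)).

(* The action on a submodule V, where vsproj V is the inverse of the          *)
(* inclusion vsval because V is stable.                                       *)
Definition sub_act (M : vectType k) (V : {vspace M})
    (act : drinfeld_double -> M -> M) (d : drinfeld_double) (v : subvs_of V) : subvs_of V :=
  vsproj V (act d (vsval v)).

Definition twist_act (chi : hdual) (h a : H) : H :=
  sweedler (comul h) (fun h1 h2 =>
    sweedler (comul h2) (fun h21 h22 => (chi h21 : k) *: h22)
      * a * antipodeV h1).

End DrinfeldDouble.

Section Lattice.
Variable n : nat.

(* The indices 1, ..., n are shifted to 0, ..., n - 1. *)
Definition lattice := {ffun 'I_n -> int}.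

Implicit Types al be : lattice.

Definition eps (i : 'I_n) : lattice := [ffun j => (i == j : nat)%:Z].

Definition star al be : int :=
  \sum_(j < n) \sum_(i < n | (j < i)%N) al i * be j.

Definition pairing al be : int := \sum_(i < n) al i * be i.

Definition theta (k : fieldType) (q : k) al be : k :=
  q ^ (star al be - star be al).

Definition in_box (ell : nat) al : Prop :=
  forall i, (0 <= al i <= ell%:Z - 1)%R.

Definition tilde be : lattice :=
  [ffun i : 'I_n => \sum_(j < n | (j <= i)%N) be j - \sum_(j < n | (i < j)%N) be j].

Definition residue (ell : nat) al : lattice := [ffun i => (al i %% ell%:Z)%Z].

Definition kappa (ell : nat) al be : lattice :=
  residue ell (- tilde be + be *+ 2 - al).

(* The elements of the box, as a finite type used to index bases. *)
Definition box (ell : nat) := {ffun 'I_n -> 'I_ell}.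

Definition box_val (ell : nat) (a : box ell) : lattice :=
  [ffun i => (a i : nat)%:Z].

End Lattice.

Section Taft.
Variables (k : fieldType) (n ell : nat) (q : k).

(* The relations between the generators K(eps_i), K(eps_i)^-1 and x_i. *)
Definition taft_relations (B : algType k) (K Kinv x : 'I_n -> B) : Prop :=
  [/\ forall i j, K i * K j = K j * K i,
      forall i, K i * Kinv i = 1 /\ Kinv i * K i = 1,
      forall i, K i ^+ ell = 1,
      forall i j, K i * x j * Kinv i =
        (theta q (eps i) (eps j) * q ^+ (i == j)) *: x j
    & (forall i j, x i * x j = theta q (eps i) (eps j) *: (x j * x i))
      /\ (forall i, x i ^+ ell = 0)].

Section Monomials.
Variables (H : falgType k) (K x : 'I_n -> H).

Definition Kprod (al : lattice n) : H := \prod_(i < n) K i ^ al i.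

Definition xprod (ga : lattice n) : H := \prod_(i < n) x i ^+ `|ga i|%N.

Definition taft_monomials : #|{: box n ell * box n ell}|.-tuple H :=
  [tuple let ga_al := enum_val i in
     xprod (box_val ga_al.1) * Kprod (box_val ga_al.2)
   | i < #|{: box n ell * box n ell}|].

End Monomials.

(* The n-rank Taft algebra: the algebra presented by the relations above,     *)
(* with the given values of the Hopf structure on the generators.  The        *)
(* presentation is the universal property; that the monomials form a basis    *)
(* follows from it, and is recorded because the characters below are defined  *)
(* by their values on that basis.                                             *)
Record taft_algebra := TaftAlgebra {
  taft_hopf :> hopfAlgType k;
  taftK : 'I_n -> taft_hopf;
  taftx : 'I_n -> taft_hopf;
  taft_relP : taft_relations taftK (fun i => (taftK i)^-1) taftx;
  taft_univ : forall (B : algType k) (K Kinv x : 'I_n -> B),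
    taft_relations K Kinv x ->
    exists2 f : {lrmorphism taft_hopf -> B},
      (forall i, f (taftK i) = K i /\ f (taftx i) = x i)
    & forall g : {lrmorphism taft_hopf -> B},
        (forall i, g (taftK i) = K i /\ g (taftx i) = x i) -> g =1 f;
  taft_basis : basis_of fullv (taft_monomials taftK taftx);
  taft_comulK : forall i, comul (taftK i) = taftK i (x) taftK i;
  taft_comulx : forall i,
    comul (taftx i) = taftx i (x) 1 + taftK i (x) taftx i;
  taft_counitK : forall i, counit (taftK i) = 1;
  taft_counitx : forall i, counit (taftx i) = 0;
  taft_antipodeK : forall i, antipode (taftK i) = (taftK i)^-1;
  taft_antipodex : forall i, antipode (taftx i) = - ((taftK i)^-1 * taftx i)
}.

Variable A : taft_algebra.

Definition taft_coord (ga be : box n ell) (h : A) : k :=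
  coord (taft_monomials (@taftK A) (@taftx A)) (enum_rank (ga, be)) h.

Definition taft_char (al : lattice n) : hdual A :=
  linfun (fun h => \sum_(ga : box n ell) \sum_(be : box n ell)
    taft_coord ga be h *
      (if box_val ga == 0 then q ^ pairing al (box_val be) else 0) : k^o).

Definition taft_simple (al be : lattice n) : {vspace A} :=
  limg (linfun (fun h : A => twist_act (taft_char al) h (Kprod (@taftK A) be))).

Definition taft_simple_act (al be : lattice n) :
    drinfeld_double A ->
    subvs_of (taft_simple al be) -> subvs_of (taft_simple al be) :=
  sub_act (yd_double_act (twist_act (taft_char al)) (@comul k A)).

End Taft.

Arguments taft_simple {k n ell q} A al be.
Arguments taft_simple_act {k n ell q} A al be d v.

(* Main.v *)
Require Import Defs.
From HB Require Import structures.
From mathcomp Require Import all_boot all_order all_algebra all_field ring zify.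

Set Implicit Arguments.
Unset Strict Implicit.
Unset Printing Implicit Defensive.

Import GRing.Theory VectorInternalTheory.
Local Open Scope ring_scope.

(** Write H for the Taft algebra, chi_al for the character K_i |-> q^(al_i),
x_i |-> 0, and A(al, be) for the module generated by K(be) in H, on which D(H)
acts through the twisted adjoint action of H and the coaction given by the
coproduct.

Explicitly, x_i sends the vector v_g = x^g K(be - g) to a multiple of
v_(g + eps_i), and the coefficient vanishes exactly when g_i is the i-th
component of kappa = kappa(al, be).  Hence the v_g with g <= kappa form a basis
of A(al, be) ([cyclic_wbasis], [free_wbasis]), which gives its dimension.  The
two ends of this basis are v_0 = K(be), which spans the only group-like line,
and the top vector v_kappa, which is killed by every x_i.

Self-duality compares these two ends.  An isomorphism of A(al, be) with its dual
is a nondegenerate invariant bilinear form; as the x_i kill v_kappa and move v_0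
through the whole module, the form pairs v_0 and v_kappa nontrivially, so the
H^*-weights be and be - kappa of these two vectors are opposite and
kappa = 2 be modulo ell ([self_dual_weight], [self_dual_kappa]).  By definition
of kappa this says that al = - tilde be modulo ell.  Conversely, if this holds,
then evaluation at v_kappa is a functional on the dual module on which H acts
through chi_al.  Such a functional phi on a module M induces a D(H)-map
m |-> phi(m_(0)) m_(1) from M to H, because H with its twisted action is the
coinduced module of the character.  For M the dual of A(al, be) the image of
this map contains K(be), hence A(al, be), and a comparison of dimensions makes
it an isomorphism onto A(al, be) ([extremal_self_dual]).

The same coinduced map classifies the irreducible modules.  On any D(H)-module
the x_i are nilpotent and q-commute with all generators of H, and the K_i are
diagonalizable, so there is a functional phi as above for some al
([weight_functional]).  On an irreducible M its coinduced map is injective, and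
its image, being a nonzero subcomodule of H, contains some K(be)
([coideal_group_like]); so M is A(al, be) ([taft_simple_exhaust]).  The pair
(al, be) can be read off from the group-like line, so it is an invariant
([taft_simple_inj]).  For self-dual modules kappa = [2 be] determines be because
ell is odd, and then al.

All identities in H and D(H) are checked on the generators K_i and x_i and
propagated along products ([sg_ind]).  To avoid sums over coproducts they are
expressed by the operators a |-> a_(1) p(a_(2)) and a |-> p(a_(1)) a_(2) for p in
the dual of H, which see a coproduct one functional at a time. *)

(** * Sweedler calculus *)

Section Sweedler.
Variable k : fieldType.

Definition bilin (U V : vectType k) (W : lmodType k) (B : U -> V -> W) : Prop :=
  (forall v, linear (B^~ v)) /\ (forall u, linear (B u)).

Lemma sweedler_is_linear (U V : vectType k) (W : lmodType k) (B : U -> V -> W) :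
  linear (fun t : tensor U V => sweedler t B).
Proof.
move=> c t t'; rewrite /sweedler scaler_sumr -big_split /=.
apply: eq_bigr => i _; rewrite scaler_sumr -big_split /=.
by apply: eq_bigr => j _; rewrite !mxE scalerDl scalerA.
Qed.

Lemma sweedlerP (U V : vectType k) (W : lmodType k) (B : U -> V -> W) c
    (t t' : tensor U V) :
  sweedler (c *: t + t') B = c *: sweedler t B + sweedler t' B.
Proof. exact: sweedler_is_linear. Qed.

Lemma sweedlerD (U V : vectType k) (W : lmodType k) (B : U -> V -> W)
    (t t' : tensor U V) :
  sweedler (t + t') B = sweedler t B + sweedler t' B.
Proof. by have:= sweedlerP B 1 t t'; rewrite !scale1r. Qed.

Lemma eq_sweedler (U V : vectType k) (W : lmodType k) (t : tensor U V)
    (B B' : U -> V -> W) :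
  (forall u v, B u v = B' u v) -> sweedler t B = sweedler t B'.
Proof. by move=> eB; apply: eq_bigr => i _; apply: eq_bigr => j _; rewrite eB. Qed.

Lemma sweedler_fun (U V : vectType k) (W W' : lmodType k) (f : W -> W')
    (t : tensor U V) (B : U -> V -> W) :
  linear f -> f (sweedler t B) = sweedler t (fun u v => f (B u v)).
Proof.
move=> fL; pose fm := GRing.isLinear.Build k W W' _ f fL.
pose g : {linear W -> W'} := HB.pack f fm.
rewrite -[f]/(g : W -> W') linear_sum; apply: eq_bigr => i _.
by rewrite linear_sum; apply: eq_bigr => j _; rewrite linearZ.
Qed.

Lemma sweedlerDr (U V : vectType k) (W : lmodType k) (t : tensor U V)
    (B B' : U -> V -> W) :
  sweedler t (fun u v => B u v + B' u v) = sweedler t B + sweedler t B'.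
Proof.
rewrite -big_split; apply: eq_bigr => i _; rewrite -big_split.
by apply: eq_bigr => j _; rewrite scalerDr.
Qed.

Lemma sweedlerZr (U V : vectType k) (W : lmodType k) (t : tensor U V) c
    (B : U -> V -> W) :
  sweedler t (fun u v => c *: B u v) = c *: sweedler t B.
Proof. by rewrite -sweedler_fun // => a u v; rewrite scalerDr !scalerA mulrC. Qed.

Lemma sweedlerPr (U V : vectType k) (W : lmodType k) (t : tensor U V) c
    (B B' : U -> V -> W) :
  sweedler t (fun u v => c *: B u v + B' u v) = c *: sweedler t B + sweedler t B'.
Proof. by rewrite sweedlerDr sweedlerZr. Qed.

Lemma tensPl (U V : vectType k) c (u u' : U) (v : V) :
  (c *: u + u') (x) v = c *: (u (x) v) + u' (x) v.
Proof. by rewrite /tens !linearP mulmxDl -scalemxAl. Qed.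

Lemma tensPr (U V : vectType k) c (u : U) (v v' : V) :
  u (x) (c *: v + v') = c *: (u (x) v) + u (x) v'.
Proof. by rewrite /tens linearP /= mulmxDr -scalemxAr. Qed.

Lemma tensZl (U V : vectType k) c (u : U) (v : V) : (c *: u) (x) v = c *: (u (x) v).
Proof. by rewrite /tens !linearZ /= -scalemxAl. Qed.

Lemma tensZr (U V : vectType k) c (u : U) (v : V) : u (x) (c *: v) = c *: (u (x) v).
Proof. by rewrite /tens linearZ /= -scalemxAr. Qed.

Lemma bvec_expand (U : vectType k) (u : U) :
  u = \sum_(i < dim U) v2r u 0 i *: bvec i.
Proof.
rewrite -[LHS]v2rK {1}[v2r u]row_sum_delta linear_sum.
by apply: eq_bigr => i _; rewrite linearZ.
Qed.

Lemma v2r_bvec (U : vectType k) (i j : 'I_(dim U)) :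
  v2r (bvec i) 0 j = (j == i)%:R.
Proof. by rewrite r2vK mxE eqxx. Qed.

(** Every tensor is a sum of pure tensors; this is what makes [tensor_ind] an
induction principle. *)
Lemma sweedler_id (U V : vectType k) (t : tensor U V) :
  sweedler t (fun u v => u (x) v) = t.
Proof.
apply/matrixP=> a b; rewrite summxE (bigD1 a) //= summxE (bigD1 b) //=.
rewrite !mxE big_ord1 mxE !v2r_bvec !eqxx !mulr1.
rewrite big1 => [|j jb]; last first.
  by rewrite !mxE big_ord1 mxE !v2r_bvec eqxx [b == j]eq_sym (negPf jb) !mulr0.
rewrite big1 => [|i ia]; first by rewrite !addr0.
rewrite summxE big1 // => j _.
by rewrite !mxE big_ord1 mxE !v2r_bvec [a == i]eq_sym (negPf ia) mul0r mulr0.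
Qed.

Lemma tensor_ind (U V : vectType k) (P : tensor U V -> Prop) :
  (forall c t t', P t -> P t' -> P (c *: t + t')) ->
  (forall u v, P (u (x) v)) -> forall t, P t.
Proof.
move=> PL Pt t.
have P0 : P 0.
  have:= PL (- 1) _ _ (Pt 0 0) (Pt 0 0).
  by rewrite scaleN1r addNr.
rewrite -[t]sweedler_id /sweedler.
have Psum (I : Type) (r : seq I) F : (forall i, P (F i)) -> P (\sum_(i <- r) F i).
  move=> PF; elim/big_rec: _ => // i y _ Py.
  by rewrite -[F i]scale1r; apply: PL.
apply: (Psum) => i; apply: (Psum) => j.
by rewrite -[_ *: _]addr0; apply: PL.
Qed.

Lemma linear_fun (U W : lmodType k) (f : U -> W) : linear f ->
  [/\ f 0 = 0, forall u v, f (u + v) = f u + f v,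
      forall c u, f (c *: u) = c *: f u & forall u, f (- u) = - f u].
Proof.
move=> fL; pose fm := GRing.isLinear.Build k U W _ f fL.
pose g : {linear U -> W} := HB.pack f fm.
split; first exact: (linear0 g).
- exact: (linearD g).
- exact: (linearZ_LR g).
exact: (linearN g).
Qed.

End Sweedler.

(** For maps that are not bundled with a proof of linearity. *)
Section LinfunE.
Variables (k : fieldType) (U V : vectType k).
Lemma linfunE (f : U -> V) : linear f -> forall u, linfun f u = f u.
Proof.
move=> fL u; pose fm := GRing.isLinear.Build k U V _ f fL.
pose g : {linear U -> V} := HB.pack f fm.
exact: (lfunE g).
Qed.
End LinfunE.

(** Proves linearity of an expression built from products and linear maps. *)
Ltac lin :=
  intros; let c := fresh "c" in let a := fresh "a" in let b := fresh "b" in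
  move=> c a b /=;
  rewrite ?(linearP, mulrDl, mulrDr, scalerDl, scalerDr, tensPl, tensPr);
  rewrite -?(scalerAl, scalerAr) ?scalerA //.

(** * Slices of the coproduct *)
Section HopfSlices.
Variables (k : fieldType) (H : hopfAlgType k).
Implicit Types (g h x y : H) (p : hdual H).

Lemma hdualP p c (a b : H) : (p (c *: a + b) : k) = c * (p a : k) + (p b : k).
Proof. by rewrite linearP. Qed.

Lemma hdualPl p p' c (a : H) : ((c *: p + p') a : k) = c * (p a : k) + (p' a : k).
Proof. by rewrite lfunE /= lfunE. Qed.

Lemma comulP c g h : comul (c *: g + h) = c *: comul g + comul h.
Proof. by rewrite linearP. Qed.

(** The coassociativity axiom equates two tensors; any trilinear T factors through
the triple tensor product, so it may be applied to both sides. *)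
Lemma sweedler_coassoc (W : lmodType k) (T : H -> H -> H -> W) h :
    (forall b c, linear (fun a => T a b c)) ->
    (forall a c, linear (fun b => T a b c)) ->
    (forall a b, linear (fun c => T a b c)) ->
  sweedler (comul h) (fun ab c => sweedler (comul ab) (fun a b => T a b c)) =
  sweedler (comul h) (fun a bc => sweedler (comul bc) (fun b c => T a b c)).
Proof.
move=> T1 T2 T3.
pose Phi (t : tensor H (tensor H H)) := sweedler t (fun a s => sweedler s (T a)).
have PhiL : linear Phi by exact: sweedler_is_linear.
have PhiE a s : Phi (a (x) s) = sweedler s (T a).
  rewrite /Phi sweedler_tens // => [s0|a0]; last exact: sweedler_is_linear.
  move=> c u v; rewrite -sweedlerPr; apply: eq_sweedler => b d.
  exact: T1.
have := congr1 Phi (comulA h); rewrite !(sweedler_fun _ _ PhiL) => eA.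
transitivity (sweedler (comul h) (fun a b => Phi
   (sweedler (comul a) (fun a1 a2 => a1 (x) (a2 (x) b))))).
  apply: eq_sweedler => u v; rewrite (sweedler_fun _ _ PhiL).
  by apply: eq_sweedler => a b; rewrite PhiE sweedler_tens.
by rewrite eA; apply: eq_sweedler => u v; rewrite PhiE.
Qed.

Lemma sweedler_comulM (W : lmodType k) (B : H -> H -> W) g h : bilin B ->
  sweedler (comul (g * h)) B =
  sweedler (comul g) (fun a b =>
    sweedler (comul h) (fun c d => B (a * c) (b * d))).
Proof.
move=> [Bl Br]; rewrite comulM /tens_mul.
have BL : linear (fun t : tensor H H => sweedler t B) by exact: sweedler_is_linear.
rewrite (sweedler_fun _ _ BL); apply: eq_sweedler => a b.
rewrite (sweedler_fun _ _ BL); apply: eq_sweedler => c d.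
by rewrite sweedler_tens.
Qed.

(** Coproducts of products with a group-like g (suffix G) or with a skew-primitive
x (suffix S), on either side. *)
Section Gens.
Variables (W : lmodType k) (B : H -> H -> W).
Hypothesis bB : bilin B.

Lemma sweedler_comul1 : sweedler (comul 1) B = B 1 1.
Proof. by case: bB => Bl Br; rewrite comul1 sweedler_tens. Qed.

Lemma bilin_mull g h : bilin (fun a b => B (g * a) (h * b)).
Proof.
case: bB => Bl Br; split=> u c a b; rewrite mulrDr -scalerAr.
  exact: Bl.
exact: Br.
Qed.

Lemma sweedler_comulGl g h : comul g = g (x) g ->
  sweedler (comul (g * h)) B = sweedler (comul h) (fun a b => B (g * a) (g * b)).
Proof.
move=> gg; rewrite sweedler_comulM // gg sweedler_tens // => b c u v.
  rewrite -sweedlerPr; apply: eq_sweedler => a d.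
  by rewrite mulrDl -scalerAl bB.1.
rewrite -sweedlerPr; apply: eq_sweedler => a d.
by rewrite mulrDl -scalerAl bB.2.
Qed.

Lemma sweedler_comulGr g h : comul g = g (x) g ->
  sweedler (comul (h * g)) B = sweedler (comul h) (fun a b => B (a * g) (b * g)).
Proof.
move=> gg; rewrite sweedler_comulM // gg; apply: eq_sweedler => a b.
by rewrite sweedler_tens // => u; [case: (bilin_mull a b) => + _|case: (bilin_mull a b) => _ +].
Qed.

Lemma sweedler_comulSl x g h : comul x = x (x) 1 + g (x) x ->
  sweedler (comul (x * h)) B = sweedler (comul h) (fun a b => B (x * a) b)
    + sweedler (comul h) (fun a b => B (g * a) (x * b)).
Proof.
move=> xx; rewrite sweedler_comulM // xx sweedlerD.
have lem (u v : H) : sweedler (u (x) v)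
    (fun a b => sweedler (comul h) (fun c d => B (a * c) (b * d))) =
    sweedler (comul h) (fun c d => B (u * c) (v * d)).
  rewrite sweedler_tens // => b c a a'.
    rewrite -sweedlerPr; apply: eq_sweedler => e d.
    by rewrite mulrDl -scalerAl bB.1.
  rewrite -sweedlerPr; apply: eq_sweedler => e d.
  by rewrite mulrDl -scalerAl bB.2.
rewrite !lem; congr (_ + _); apply: eq_sweedler => a b; by rewrite mul1r.
Qed.

Lemma sweedler_comulSr x g h : comul x = x (x) 1 + g (x) x ->
  sweedler (comul (h * x)) B = sweedler (comul h) (fun a b => B (a * x) b)
    + sweedler (comul h) (fun a b => B (a * g) (b * x)).
Proof.
move=> xx; rewrite sweedler_comulM // xx -sweedlerDr; apply: eq_sweedler => a b.
rewrite sweedlerD !sweedler_tens ?mulr1 // => u;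
  by [case: (bilin_mull a b) => + _|case: (bilin_mull a b) => _ +].
Qed.

End Gens.

(** [rslice p] is the action of p in H^* coming from the right coaction of H on
itself; [lslice p] is its left analogue. *)
Definition rslice p : 'End(H) :=
  linfun (fun h => sweedler (comul h) (fun a b => (p b : k) *: a)).

Definition lslice p : 'End(H) :=
  linfun (fun h => sweedler (comul h) (fun a b => (p a : k) *: b)).

Lemma bilin_scale_r p : bilin (fun a b : H => (p b : k) *: a).
Proof.
split=> u c a b; first by rewrite scalerDr !scalerA mulrC.
by rewrite hdualP scalerDl scalerA.
Qed.

Lemma bilin_scale_l p : bilin (fun a b : H => (p a : k) *: b).
Proof.
split=> u c a b; last by rewrite scalerDr !scalerA mulrC.
by rewrite hdualP scalerDl scalerA.
Qed.

Lemma rsliceE p h :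
  rslice p h = sweedler (comul h) (fun a b => (p b : k) *: a).
Proof. by rewrite linfunE // => c a b; rewrite comulP sweedlerP. Qed.

Lemma lsliceE p h :
  lslice p h = sweedler (comul h) (fun a b => (p a : k) *: b).
Proof. by rewrite linfunE // => c a b; rewrite comulP sweedlerP. Qed.

Lemma rslicePl p p' c h : rslice (c *: p + p') h = c *: rslice p h + rslice p' h.
Proof.
rewrite !rsliceE -sweedlerPr; apply: eq_sweedler => a b.
by rewrite hdualPl scalerDl scalerA.
Qed.

Lemma lslicePl p p' c h : lslice (c *: p + p') h = c *: lslice p h + lslice p' h.
Proof.
rewrite !lsliceE -sweedlerPr; apply: eq_sweedler => a b.
by rewrite hdualPl scalerDl scalerA.
Qed.

Lemma eq_rslice p p' h : p =1 p' -> rslice p h = rslice p' h.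
Proof. by move=> /lfunP->. Qed.

Lemma eq_lslice p p' h : p =1 p' -> lslice p h = lslice p' h.
Proof. by move=> /lfunP->. Qed.

Lemma rslice1 p : rslice p 1 = (p 1 : k) *: 1.
Proof. by rewrite rsliceE sweedler_comul1 //; exact: bilin_scale_r. Qed.

Lemma lslice1 p : lslice p 1 = (p 1 : k) *: 1.
Proof. by rewrite lsliceE sweedler_comul1 //; exact: bilin_scale_l. Qed.

Lemma rslice_counit h : rslice counit h = h.
Proof. by rewrite rsliceE counitr. Qed.

Lemma lslice_counit h : lslice counit h = h.
Proof. by rewrite lsliceE counitl. Qed.

Definition pull_l p g : hdual H := (p \o amull g)%VF.
Definition pull_r p g : hdual H := (p \o amulr g)%VF.

Lemma pull_lE p g h : pull_l p g h = p (g * h).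
Proof. by rewrite lfunE /= lfunE. Qed.
Lemma pull_rE p g h : pull_r p g h = p (h * g).
Proof. by rewrite lfunE /= lfunE. Qed.

Lemma hdual_mulE p p' h :
  hdual_mul p p' h = sweedler (comul h) (fun a b => p a * p' b : k^o).
Proof. by rewrite linfunE // => c a b; rewrite comulP sweedlerP. Qed.

Lemma hdual_mul_rslice p p' h : hdual_mul p p' h = p (rslice p' h).
Proof.
rewrite hdual_mulE rsliceE (sweedler_fun _ _ (f := p)); last exact: linearP.
by apply: eq_sweedler => a b; rewrite linearZ /= mulrC.
Qed.

Lemma hdual_mul_lslice p p' h : hdual_mul p p' h = p' (lslice p h).
Proof.
rewrite hdual_mulE lsliceE (sweedler_fun _ _ (f := p')); last exact: linearP.
by apply: eq_sweedler => a b; rewrite linearZ.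
Qed.

Lemma lslice_mul p p' h : lslice p (lslice p' h) = lslice (hdual_mul p' p) h.
Proof.
rewrite [lslice p' h]lsliceE (sweedler_fun _ _ (f := lslice p)); last exact: linearP.
transitivity (sweedler (comul h) (fun a bc =>
   sweedler (comul bc) (fun b c => ((p' a : k) * (p b : k)) *: c))).
  apply: eq_sweedler => a c; rewrite linearZ /= lsliceE -sweedlerZr.
  by apply: eq_sweedler => u v; rewrite scalerA.
rewrite -sweedler_coassoc; first last.
- by move=> a b c u v; rewrite scalerDr !scalerA mulrC.
- by move=> a b c u v; rewrite hdualP mulrDr scalerDl scalerA mulrCA.
- by move=> a b c u v; rewrite hdualP mulrDl scalerDl scalerA mulrA.
rewrite lsliceE; apply: eq_sweedler => ab c; rewrite hdual_mulE.
have L : linear (fun d : k^o => (d : k) *: c).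
  by move=> d u v; rewrite scalerDl scalerA.
by rewrite -(sweedler_fun _ _ L).
Qed.

Lemma rsliceGl p g h : comul g = g (x) g ->
  rslice p (g * h) = g * rslice (pull_l p g) h.
Proof.
move=> gg; rewrite [LHS]rsliceE (sweedler_comulGl _ _ gg); last exact: bilin_scale_r.
rewrite rsliceE (sweedler_fun _ _ (f := fun a => g * a)); last by lin.
by apply: eq_sweedler => a b; rewrite pull_lE -scalerAr.
Qed.

Lemma rsliceGr p g h : comul g = g (x) g ->
  rslice p (h * g) = rslice (pull_r p g) h * g.
Proof.
move=> gg; rewrite [LHS]rsliceE (sweedler_comulGr _ _ gg); last exact: bilin_scale_r.
rewrite rsliceE (sweedler_fun _ _ (f := fun a => a * g)); last by lin.
by apply: eq_sweedler => a b; rewrite pull_rE -scalerAl.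
Qed.

Lemma rsliceSl p x g h : comul x = x (x) 1 + g (x) x ->
  rslice p (x * h) = x * rslice p h + g * rslice (pull_l p x) h.
Proof.
move=> xx; rewrite [LHS]rsliceE (sweedler_comulSl _ _ xx); last exact: bilin_scale_r.
rewrite !rsliceE (sweedler_fun _ _ (f := fun a => g * a)); last by lin.
rewrite (sweedler_fun _ _ (f := fun a => x * a)); last by lin.
by congr (_ + _); apply: eq_sweedler => a b; rewrite ?pull_lE -scalerAr.
Qed.

Lemma rsliceSr p x g h : comul x = x (x) 1 + g (x) x ->
  rslice p (h * x) = rslice p h * x + rslice (pull_r p x) h * g.
Proof.
move=> xx; rewrite [LHS]rsliceE (sweedler_comulSr _ _ xx); last exact: bilin_scale_r.
rewrite !rsliceE (sweedler_fun _ _ (f := fun a => a * g)); last by lin.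
rewrite (sweedler_fun _ _ (f := fun a => a * x)); last by lin.
by congr (_ + _); apply: eq_sweedler => a b; rewrite ?pull_rE -scalerAl.
Qed.

Lemma lsliceGl p g h : comul g = g (x) g ->
  lslice p (g * h) = g * lslice (pull_l p g) h.
Proof.
move=> gg; rewrite [LHS]lsliceE (sweedler_comulGl _ _ gg); last exact: bilin_scale_l.
rewrite lsliceE (sweedler_fun _ _ (f := fun a => g * a)); last by lin.
by apply: eq_sweedler => a b; rewrite pull_lE -scalerAr.
Qed.

Lemma lsliceGr p g h : comul g = g (x) g ->
  lslice p (h * g) = lslice (pull_r p g) h * g.
Proof.
move=> gg; rewrite [LHS]lsliceE (sweedler_comulGr _ _ gg); last exact: bilin_scale_l.
rewrite lsliceE (sweedler_fun _ _ (f := fun a => a * g)); last by lin.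
by apply: eq_sweedler => a b; rewrite pull_rE -scalerAl.
Qed.

Lemma lsliceSl p x g h : comul x = x (x) 1 + g (x) x ->
  lslice p (x * h) = lslice (pull_l p x) h + x * lslice (pull_l p g) h.
Proof.
move=> xx; rewrite [LHS]lsliceE (sweedler_comulSl _ _ xx); last exact: bilin_scale_l.
rewrite !lsliceE (sweedler_fun _ _ (f := fun a => x * a)); last by lin.
by congr (_ + _); apply: eq_sweedler => a b; rewrite ?pull_lE -?scalerAr.
Qed.

Lemma lsliceSr p x g h : comul x = x (x) 1 + g (x) x ->
  lslice p (h * x) = lslice (pull_r p x) h + lslice (pull_r p g) h * x.
Proof.
move=> xx; rewrite [LHS]lsliceE (sweedler_comulSr _ _ xx); last exact: bilin_scale_l.
rewrite !lsliceE (sweedler_fun _ _ (f := fun a => a * x)); last by lin.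
by congr (_ + _); apply: eq_sweedler => a b; rewrite ?pull_rE -?scalerAl.
Qed.

(** The identity of H is invertible under convolution, with inverse the antipode,
so u can be recovered from the convolution u * id as u * id * S. *)
Lemma convolution_inj (u v : 'End(H)) :
    (forall h, sweedler (comul h) (fun a b => u a * b) =
               sweedler (comul h) (fun a b => v a * b)) ->
  u = v.
Proof.
move=> e; apply/lfunP => h.
have key (w : 'End(H)) : w h = sweedler (comul h) (fun ab c =>
    sweedler (comul ab) (fun a b => w a * b) * antipode c).
  transitivity (sweedler (comul h) (fun ab c =>
      sweedler (comul ab) (fun a b => w a * b * antipode c))).
    rewrite sweedler_coassoc; first last.
    - by move=> a b; lin.
    - by move=> a b; lin.
    - by move=> a b; lin.
    transitivity (sweedler (comul h) (fun a bc => w a * (counit bc : k)%:A)).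
      rewrite -[h in LHS]counitr (sweedler_fun _ _ (f := w)); last exact: linearP.
      by apply: eq_sweedler => a b; rewrite linearZ -scalerAr mulr1.
    apply: eq_sweedler => a b; rewrite -antipoder.
    rewrite (sweedler_fun _ _ (f := fun y => w a * y)); last by lin.
    by apply: eq_sweedler => c d; rewrite mulrA.
  apply: eq_sweedler => a b.
  by rewrite (sweedler_fun _ _ (f := fun y => y * antipode b)); last by lin.
by rewrite !key; apply: eq_sweedler => a b; rewrite e.
Qed.

End HopfSlices.

(** * Multiplication in the Drinfeld double *)
Section Double.
Variables (k : fieldType) (H : hopfAlgType k).
Implicit Types (g h x y : H) (p : hdual H) (t : drinfeld_double H).

Lemma bcovecE (U : vectType k) (i : 'I_(dim U)) u : bcovec i u = v2r u 0 i.
Proof. by rewrite linfunE // => c a b; rewrite linearP !mxE. Qed.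

(** The defining property of the coproduct of the dual. *)
Lemma hdual_comul_eval (p : hdual H) (g h : H) :
  sweedler (hdual_comul p) (fun p1 p2 => (p1 g : k) * (p2 h : k) : k^o) = p (g * h).
Proof.
pose L1 := GRing.isLinear.Build k _ _ _ _ (@sweedler_is_linear k (hdual H) (hdual H) _
   (fun p1 p2 => (p1 g : k) * (p2 h : k) : k^o)).
pose L2 : {linear _ -> _} := HB.pack (fun t : tensor (hdual H) (hdual H) =>
    sweedler t (fun p1 p2 => (p1 g : k) * (p2 h : k) : k^o)) L1.
rewrite -[LHS]/(L2 _) /hdual_comul linear_sum.
rewrite [in RHS](bvec_expand g) [in RHS](bvec_expand h).
rewrite mulr_suml linear_sum; apply: eq_bigr => i _.
rewrite mulr_sumr 2!linear_sum; apply: eq_bigr => j _.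
rewrite linearZ /= sweedler_tens; first last.
- by move=> u c a b; rewrite hdualPl mulrDr mulrCA; exact: erefl.

- by move=> u c a b; rewrite hdualPl mulrDl -mulrA; exact: erefl.
rewrite -scalerAl -scalerAr !linearZ /= !bcovecE.
congr (_ *: _); exact: mulrC.
Qed.

Lemma hitlE h p : hitl h p = pull_r p h.
Proof.
apply/lfunP => g; rewrite pull_rE -hdual_comul_eval /hitl.
rewrite (sweedler_fun _ _ (f := fun r : hdual H => r g)).
  by apply: eq_sweedler => a b; rewrite scale_lfunE mulrC.
by move=> c a b; rewrite !lfunE /= lfunE.
Qed.

Lemma hitrE h p : hitr p h = pull_l p h.
Proof.
apply/lfunP => g; rewrite pull_lE -hdual_comul_eval /hitr.
rewrite (sweedler_fun _ _ (f := fun r : hdual H => r g)).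
  by apply: eq_sweedler => a b; rewrite scale_lfunE.
by move=> c a b; rewrite !lfunE /= lfunE.
Qed.

Lemma pull_lPl c p p' g : pull_l (c *: p + p') g = c *: pull_l p g + pull_l p' g.
Proof. by apply/lfunP => h; rewrite !pull_lE !hdualPl !pull_lE. Qed.
Lemma pull_rPl c p p' g : pull_r (c *: p + p') g = c *: pull_r p g + pull_r p' g.
Proof. by apply/lfunP => h; rewrite !pull_rE !hdualPl !pull_rE. Qed.
Lemma pull_lPr c p g g' : pull_l p (c *: g + g') = c *: pull_l p g + pull_l p g'.
Proof.
by apply/lfunP => h; rewrite !pull_lE !hdualPl !pull_lE mulrDl -scalerAl hdualP.
Qed.
Lemma pull_rPr c p g g' : pull_r p (c *: g + g') = c *: pull_r p g + pull_r p g'.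
Proof.
by apply/lfunP => h; rewrite !pull_rE !hdualPl !pull_rE mulrDr -scalerAr hdualP.
Qed.
Lemma hdual_mulPl c p p' r :
  hdual_mul (c *: p + p') r = c *: hdual_mul p r + hdual_mul p' r.
Proof. by apply/lfunP => h; rewrite hdualPl !hdual_mul_rslice hdualPl. Qed.
Lemma hdual_mulPr c p p' r :
  hdual_mul r (c *: p + p') = c *: hdual_mul r p + hdual_mul r p'.
Proof. by apply/lfunP => h; rewrite hdualPl !hdual_mul_lslice hdualPl. Qed.

(** Iterated coproducts, bracketed as in the multiplication of D(H). *)
Section Sweedler3.
Variable W : lmodType k.
Implicit Type T : H -> H -> H -> W.

Definition trilin T : Prop :=
  [/\ forall b c, linear (fun a => T a b c), forall a c, linear (fun b => T a b c)
    & forall a b, linear (T a b)].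

Definition sweedler3 h T :=
  sweedler (comul h) (fun ab c => sweedler (comul ab) (fun a b => T a b c)).

Lemma eq_sweedler3 h T T' : (forall a b c, T a b c = T' a b c) ->
  sweedler3 h T = sweedler3 h T'.
Proof. by move=> e; apply: eq_sweedler => ab c; apply: eq_sweedler => a b. Qed.

Lemma sweedler3_is_linear T : linear (sweedler3^~ T).
Proof. by move=> c h h'; rewrite /sweedler3 comulP sweedlerP. Qed.

Lemma sweedler3Pr c h T T' :
  sweedler3 h (fun x y z => c *: T x y z + T' x y z) =
  c *: sweedler3 h T + sweedler3 h T'.
Proof.
rewrite /sweedler3 -sweedlerPr; apply: eq_sweedler => a b.
by rewrite -sweedlerPr.
Qed.

Lemma sweedler3Dr h T T' :
  sweedler3 h (fun x y z => T x y z + T' x y z) = sweedler3 h T + sweedler3 h T'.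
Proof.
have:= sweedler3Pr 1 h T T'; rewrite scale1r => <-.
by apply: eq_sweedler3 => *; rewrite scale1r.
Qed.

Lemma trilin_inner T : trilin T ->
  bilin (fun ab c => sweedler (comul ab) (fun a b => T a b c)).
Proof.
move=> [T1 T2 T3]; split=> u c a b; first by rewrite comulP sweedlerP.
by rewrite -sweedlerPr; apply: eq_sweedler => a' b'; rewrite T3.
Qed.

Lemma trilin_bilin T c : trilin T -> bilin (fun a b => T a b c).
Proof. by case=> T1 T2 _; split. Qed.

Lemma sweedler3_1 T : trilin T -> sweedler3 1 T = T 1 1 1.
Proof.
move=> Tl; rewrite /sweedler3 sweedler_comul1; last exact: trilin_inner.
by rewrite sweedler_comul1; last exact: trilin_bilin.
Qed.

Lemma sweedler3_G g h T : comul g = g (x) g -> trilin T ->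
  sweedler3 (g * h) T = sweedler3 h (fun a b c => T (g * a) (g * b) (g * c)).
Proof.
move=> gg Tl; rewrite /sweedler3 (sweedler_comulGl _ _ gg); last exact: trilin_inner.
apply: eq_sweedler => a c; rewrite (sweedler_comulGl _ _ gg) //.
exact: trilin_bilin.
Qed.

Lemma sweedler3_S x g h T : comul g = g (x) g -> comul x = x (x) 1 + g (x) x ->
    trilin T ->
  sweedler3 (x * h) T =
  sweedler3 h (fun a b c => T (x * a) b c) +
  sweedler3 h (fun a b c => T (g * a) (x * b) c) +
  sweedler3 h (fun a b c => T (g * a) (g * b) (x * c)).
Proof.
move=> gg xx Tl.
rewrite /sweedler3 (sweedler_comulSl _ _ xx); last exact: trilin_inner.
congr (_ + _).
  rewrite -sweedlerDr; apply: eq_sweedler => a c.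
  by rewrite (sweedler_comulSl _ _ xx); last exact: trilin_bilin.
apply: eq_sweedler => a c.
by rewrite (sweedler_comulGl _ _ gg); last exact: trilin_bilin.
Qed.

End Sweedler3.

Definition double_kernel p h p' h' (h1 h2 h3 : H) : drinfeld_double H :=
  hdual_mul p (pull_l (pull_r p' h1) (antipodeV H h3)) (x) (h2 * h').

Lemma double_kernel_trilin p h p' h' : trilin (double_kernel p h p' h').
Proof.
rewrite /double_kernel; split=> u v c a b /=.
- by rewrite pull_rPr pull_lPl hdual_mulPr tensPl.
- by rewrite mulrDl -scalerAl tensPr.
by rewrite linearP pull_lPr hdual_mulPr tensPl.
Qed.

Lemma double_mul_inner_bilin p h :
  bilin (fun p' h' => sweedler3 h (double_kernel p h p' h')).
Proof.
split=> u c a b; rewrite -sweedler3Pr; apply: eq_sweedler3 => h1 h2 h3.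
  by rewrite /double_kernel pull_rPl pull_lPl hdual_mulPr tensPl.
by rewrite /double_kernel mulrDr -scalerAr tensPr.
Qed.

Lemma double_mulE t t' : double_mul t t' =
  sweedler t (fun p h => sweedler t' (fun p' h' =>
    sweedler3 h (double_kernel p h p' h'))).
Proof.
apply: eq_sweedler => p h; apply: eq_sweedler => p' h'.
apply: eq_sweedler => a b; apply: eq_sweedler => c d.
by rewrite /double_kernel hitrE hitlE.
Qed.

Lemma double_mul_tens p h p' h' :
  double_mul (p (x) h) (p' (x) h') = sweedler3 h (double_kernel p h p' h').
Proof.
rewrite double_mulE sweedler_tens; first last.
- move=> u c a b; rewrite -sweedlerPr; apply: eq_sweedler => r s.
  exact: sweedler3_is_linear.
- move=> u c a b; rewrite -sweedlerPr; apply: eq_sweedler => r s.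
  rewrite -sweedler3Pr; apply: eq_sweedler3 => h1 h2 h3.
  by rewrite /double_kernel hdual_mulPl tensPl.
by rewrite sweedler_tens //; case: (double_mul_inner_bilin p h).
Qed.

Lemma double_mul_is_linear_l t' : linear (fun t => double_mul t t').
Proof. exact: sweedler_is_linear. Qed.

Lemma double_mul_is_linear_r t : linear (double_mul t).
Proof.
move=> c a b; rewrite /double_mul -sweedlerPr; apply: eq_sweedler => p h.
exact: sweedlerP.
Qed.

Lemma double_antipode_is_linear : linear (@double_antipode k H).
Proof. exact: sweedler_is_linear. Qed.

Definition dual_antipodeV p : hdual H := (p \o antipodeV H)%VF.

Lemma dual_antipodeVE p h : dual_antipodeV p h = p (antipodeV H h).
Proof. by rewrite lfunE. Qed.

Lemma double_antipode_tens p h : double_antipode (p (x) h) =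
  double_mul ((counit : hdual H) (x) antipode h) (dual_antipodeV p (x) (1 : H)).
Proof.
rewrite /double_antipode sweedler_tens // => u c a b.
  have -> : ((c *: a + b) \o antipodeV H)%VF =
     c *: dual_antipodeV a + dual_antipodeV b :> hdual H.
    by apply/lfunP => h'; rewrite lfunE /= !hdualPl !dual_antipodeVE.
  by rewrite tensPl double_mul_is_linear_r.
by rewrite linearP tensPr double_mul_is_linear_l.
Qed.

End Double.

(** * Hopf algebras generated by group-likes and skew-primitives *)

(** Only left multiplications by the K_i and the x_i appear in [sg_ind], so that
its induction step involves the coproduct of a single generator. *)
Record skew_generated (k : fieldType) (H : hopfAlgType k) (I : Type)
    (K x : I -> H) : Prop := SkewGenerated {
  sg_unit : forall i, K i \is a GRing.unit;
  sg_comulK : forall i, comul (K i) = K i (x) K i;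
  sg_comulx : forall i, comul (x i) = x i (x) 1 + K i (x) x i;
  sg_counitK : forall i, counit (K i) = 1;
  sg_counitx : forall i, counit (x i) = 0;
  sg_antipodeK : forall i, antipode (K i) = (K i)^-1;
  sg_antipodex : forall i, antipode (x i) = - ((K i)^-1 * x i);
  sg_ind : forall P : H -> Prop,
    (forall c a b, P a -> P b -> P (c *: a + b)) -> P 1 ->
    (forall i h, P h -> P (K i * h)) -> (forall i h, P h -> P (x i * h)) ->
    forall h, P h
}.

Section SkewGeneratedTheory.
Variables (k : fieldType) (H : hopfAlgType k) (I : Type) (K x : I -> H).
Hypothesis gen : skew_generated K x.
Implicit Types (g h : H) (p : hdual H) (i : I).

Local Notation S := (@antipode k H).
Local Notation SV := (antipodeV H).

(** In the next two lemmas the candidate for S (K_i h), resp. S (x_i h), is compared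
with the true value through its convolution with the identity, which the
antipode axiom at K_i h, resp. x_i h, computes.  This gives
anti-multiplicativity one generator at a time. *)
Lemma antipode_Kl i h : S (K i * h) = S h * (K i)^-1.
Proof.
have uK := sg_unit gen i; have cK := sg_comulK gen i.
suff e : (amulr (K i) \o S \o amull (K i))%VF = S.
  by rewrite -[in RHS]e !lfunE /= !lfunE /= !lfunE /= mulrK.
apply: convolution_inj => {}h; rewrite antipodel.
transitivity (sweedler (comul (K i * h)) (fun a b => S a * b)).
  rewrite (sweedler_comulGl _ _ cK); last by split; lin.
  by apply: eq_sweedler => a b; rewrite !lfunE /= !lfunE /= !lfunE /= mulrA.
by rewrite antipodel counitM (sg_counitK gen) mul1r.
Qed.

Lemma antipode_xl i h : S (x i * h) = S h * S (x i).
Proof.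
have cx := sg_comulx gen i.
suff e : ((S \o amull (x i)) - (amulr (S (x i)) \o S))%VF = 0.
  apply/eqP; rewrite -subr_eq0; have := congr1 (fun f : 'End(H) => f h) e.
  by rewrite !lfunE /= !lfunE /= !lfunE /= !lfunE /= => ->.
apply: convolution_inj => {}h.
transitivity (sweedler (comul (x i * h)) (fun a b => S a * b)).
  rewrite (sweedler_comulSl _ _ cx); last by split; lin.
  rewrite -sweedlerDr; apply: eq_sweedler => a b.
  rewrite !lfunE /= !lfunE /= !lfunE /= !lfunE /= antipode_Kl (sg_antipodex gen).
  by rewrite mulrBl mulrN mulNr opprK !mulrA.
rewrite antipodel counitM (sg_counitx gen) mul0r scale0r.
rewrite /sweedler big1 // => a _; rewrite big1 // => b _.
by rewrite lfunE /= mul0r scaler0.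
Qed.

Lemma antipode1 : S 1 = 1.
Proof.
have := antipodel (1 : H); rewrite sweedler_comul1; last by split; lin.
by rewrite counit1 mulr1 scale1r.
Qed.

Lemma antipodeM g h : S (g * h) = S h * S g.
Proof.
move: g; apply: (sg_ind gen) => [c a b ha hb||i g hg|i g hg].
- by rewrite mulrDl -scalerAl !linearP /= ha hb mulrDr -scalerAr.
- by rewrite mul1r antipode1 mulr1.
- by rewrite -mulrA !antipode_Kl hg mulrA.
by rewrite -mulrA antipode_xl hg antipode_xl mulrA.
Qed.

Lemma antipode_KV i : S (K i)^-1 = K i.
Proof.
have uK := sg_unit gen i.
have := antipodeM (K i)^-1 (K i); rewrite mulVr // antipode1 (sg_antipodeK gen).
by move/(congr1 (fun z => K i * z)); rewrite mulr1 mulVKr.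
Qed.

(** The image of S is stable under left multiplication by the generators, since
S is anti-multiplicative and K_i and x_i are values of S. *)
Lemma antipode_surj h : exists g, S g = h.
Proof.
move: h; apply: (sg_ind gen) => [c a b [a' <-] [b' <-]||i g [h <-]|i g [h <-]].
- by exists (c *: a' + b'); rewrite linearP.
- by exists 1; exact: antipode1.
- by exists (h * (K i)^-1); rewrite antipodeM antipode_KV.
exists (- (h * (x i * (K i)^-1))).
rewrite linearN /= !antipodeM antipode_KV (sg_antipodex gen).
by rewrite mulrN mulrA mulrV ?(sg_unit gen) // mul1r mulNr opprK.
Qed.

Lemma antipodeVK h : S (SV h) = h.
Proof.
by apply: limg_lfunVK; have [g <-] := antipode_surj h; rewrite memv_img ?memvf.
Qed.

Lemma antipodeK h : SV (S h) = h.
Proof.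
apply: lker0_lfunK; rewrite -dimv_eq0.
have := limg_ker_dim S fullv; rewrite capfv.
have -> : limg S = fullv.
  apply/eqP; rewrite eqEsubv subvf; apply/subvP => g _.
  by have [h' <-] := antipode_surj g; rewrite memv_img ?memvf.
by move/(canRL (addnK _)); rewrite subnn => ->.
Qed.

Lemma antipode_inj : injective S. Proof. exact: can_inj antipodeK. Qed.

Lemma antipodeVM g h : SV (g * h) = SV h * SV g.
Proof. by apply: antipode_inj; rewrite antipodeM !antipodeVK. Qed.

Lemma antipodeV1 : SV 1 = 1.
Proof. by rewrite -[in LHS]antipode1 antipodeK. Qed.

Lemma antipodeV_K i : SV (K i) = (K i)^-1.
Proof. by rewrite -[in LHS]antipode_KV antipodeK. Qed.

Lemma antipodeV_KV i : SV (K i)^-1 = K i.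
Proof. by rewrite -(sg_antipodeK gen) antipodeK. Qed.

Lemma antipodeV_x i : SV (x i) = - (x i * (K i)^-1).
Proof.
apply: antipode_inj; rewrite antipodeVK linearN /= antipodeM antipode_KV.
by rewrite (sg_antipodex gen) mulrN opprK mulVKr // (sg_unit gen).
Qed.

Lemma counit_KV i : counit (K i)^-1 = 1.
Proof.
have := counitM (K i) (K i)^-1.
by rewrite mulrV ?(sg_unit gen) // counit1 (sg_counitK gen) mul1r => ->.
Qed.

Lemma counit_antipodeV h : counit (SV h) = counit h.
Proof.
move: h; apply: (sg_ind gen) => [c a b ha hb||i g hg|i g hg].
- by rewrite !linearP /= ha hb.
- by rewrite antipodeV1.
- by rewrite antipodeVM antipodeV_K !counitM hg counit_KV (sg_counitK gen) mulr1 mul1r.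
rewrite antipodeVM antipodeV_x mulrN linearN /= !counitM (sg_counitx gen).
by rewrite mul0r mulr0 oppr0 mul0r.
Qed.

Lemma dual_antipodeV_counit : dual_antipodeV (counit : hdual H) = counit.
Proof. by apply/lfunP => h; rewrite dual_antipodeVE counit_antipodeV. Qed.

Lemma rslice_KVr p i h :
  rslice p (h * (K i)^-1) = rslice (pull_r p (K i)^-1) h * (K i)^-1.
Proof.
have uK := sg_unit gen i.
rewrite -[in RHS](mulrVK uK h) (rsliceGr _ _ (sg_comulK gen i)) mulrK //.
by apply: eq_rslice => a; rewrite !pull_rE mulrK.
Qed.

Lemma pull_rr p g h : pull_r (pull_r p g) h = pull_r p (h * g).
Proof. by apply/lfunP => a; rewrite !pull_rE mulrA. Qed.
Lemma rsliceNl p h : rslice (- p) h = - rslice p h.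
Proof.
rewrite !rsliceE -[in RHS]scaleN1r -sweedlerZr; apply: eq_sweedler => a b.
by rewrite opp_lfunE scaleNr scaleN1r.
Qed.

Lemma lsliceNl p h : lslice (- p) h = - lslice p h.
Proof.
rewrite !lsliceE -[in RHS]scaleN1r -sweedlerZr; apply: eq_sweedler => a b.
by rewrite opp_lfunE scaleNr scaleN1r.
Qed.

(** The inverse antipode reverses the coproduct, in terms of slices. *)
Lemma rslice_antipodeV p h :
  rslice p (SV h) = SV (lslice (dual_antipodeV p) h).
Proof.
move: h p; apply: (sg_ind gen) => [c a b ha hb p||i h ih p|i h ih p].
- by rewrite !linearP /= ha hb.
- by move=> p; rewrite antipodeV1 rslice1 lslice1 linearZ /= dual_antipodeVE antipodeV1.
- rewrite antipodeVM antipodeV_K rslice_KVr ih (lsliceGl _ _ (sg_comulK gen i)).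
  rewrite antipodeVM antipodeV_K; congr (SV _ * _); apply: eq_lslice => a.
  by rewrite pull_lE !dual_antipodeVE pull_rE antipodeVM antipodeV_K.
rewrite antipodeVM antipodeV_x mulrN mulrA linearN /= rslice_KVr.
rewrite (rsliceSr _ _ (sg_comulx gen i)) !ih (lsliceSl _ _ (sg_comulx gen i)).
rewrite mulrDl mulrK ?(sg_unit gen) // [in RHS]linearD /=.
rewrite antipodeVM antipodeV_x opprD addrC.
congr (_ + _); last first.
  rewrite mulrN mulrA; congr (- (SV _ * _ * _)); apply: eq_lslice => a.
  by rewrite pull_lE !dual_antipodeVE pull_rE antipodeVM antipodeV_K.
rewrite -linearN /= -lsliceNl; congr (SV _); apply: eq_lslice => a.
rewrite pull_lE opp_lfunE !dual_antipodeVE !pull_rE antipodeVM antipodeV_x.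
by rewrite mulrN linearN /= mulrA.
Qed.

(** A character of H killing the x_i, recorded through left multiplication by the
generators to match [sg_ind]. *)
Definition is_character (chi : hdual H) (c : I -> k) : Prop :=
  [/\ chi 1 = 1, forall i h, (chi (K i * h) : k) = c i * (chi h : k)
    & forall i h, chi (x i * h) = 0].

Section Twist.
Variables (chi : hdual H) (c : I -> k).
Hypothesis chiP : is_character chi c.
Local Notation act := (twist_act chi).

Lemma twist_actE h a :
  act h a = sweedler (comul h) (fun h1 h2 => lslice chi h2 * a * SV h1).
Proof. by apply: eq_sweedler => h1 h2; rewrite lsliceE. Qed.

Lemma twist_bilin a : bilin (fun h1 h2 => lslice chi h2 * a * SV h1).
Proof.
split=> u d v w; rewrite linearP /= ?(mulrDl, mulrDr);
  by rewrite -?scalerAl -?scalerAr -?scalerAl.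
Qed.

Lemma twist_act_is_linear_l a : linear (act^~ a).
Proof. by move=> d u v; rewrite !twist_actE comulP sweedlerP. Qed.

Lemma twist_act_is_linear_r h : linear (act h).
Proof.
move=> d u v; rewrite !twist_actE -sweedlerPr; apply: eq_sweedler => h1 h2.
by rewrite mulrDr mulrDl -!(scalerAr, scalerAl).
Qed.

Lemma lslice_chiK i h : lslice chi (K i * h) = c i *: (K i * lslice chi h).
Proof.
rewrite (lsliceGl _ _ (sg_comulK gen i)) scalerAr; congr (_ * _).
rewrite !lsliceE -sweedlerZr; apply: eq_sweedler => a b.
by rewrite pull_lE scalerA; case: chiP => _ -> _.
Qed.

Lemma lslice_chix i h : lslice chi (x i * h) = c i *: (x i * lslice chi h).
Proof.
rewrite (lsliceSl _ _ (sg_comulx gen i)) scalerAr.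
rewrite [X in X + _](_ : _ = 0) ?add0r; last first.
  rewrite lsliceE /sweedler big1 // => a _; rewrite big1 // => b _.
  by case: chiP => _ _ e; rewrite pull_lE e scale0r scaler0.
congr (_ * _).
rewrite !lsliceE -sweedlerZr; apply: eq_sweedler => a b.
by rewrite pull_lE scalerA; case: chiP => _ -> _.
Qed.

Lemma twist_act1 a : act 1 a = a.
Proof.
rewrite twist_actE sweedler_comul1 ?antipodeV1 ?lslice1; last exact: twist_bilin.
by case: chiP => -> _ _; rewrite scale1r mulr1 mul1r.
Qed.

Lemma twist_actK i h a : act (K i * h) a = c i *: (K i * act h a * (K i)^-1).
Proof.
rewrite !twist_actE (sweedler_comulGl _ _ (sg_comulK gen i)); last exact: twist_bilin.
rewrite (sweedler_fun _ _ (f := fun y => c i *: (K i * y * (K i)^-1))).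
  apply: eq_sweedler => h1 h2; rewrite lslice_chiK antipodeVM antipodeV_K.
  by rewrite -!scalerAl !mulrA.
by move=> d u v; rewrite mulrDr mulrDl -!(scalerAr, scalerAl) scalerDr !scalerA mulrC.
Qed.

Lemma twist_actx i h a :
  act (x i * h) a = (c i *: (x i * act h a) - act h a * x i) * (K i)^-1.
Proof.
rewrite !twist_actE (sweedler_comulSl _ _ (sg_comulx gen i)); last exact: twist_bilin.
rewrite -sweedlerDr.
rewrite (sweedler_fun _ _ (f := fun y => (c i *: (x i * y) - y * x i) * (K i)^-1)).
  apply: eq_sweedler => h1 h2; rewrite lslice_chix !antipodeVM antipodeV_K antipodeV_x.
  by rewrite mulrBl -!scalerAl !mulrN !mulrA addrC.
move=> d u v; rewrite mulrDr [(d *: u + v) * x i]mulrDl -scalerAr.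
rewrite -[d *: u * x i]scalerAl scalerDr scalerA.
by rewrite [c i * d]mulrC -scalerA opprD addrACA -scalerBr mulrDl -scalerAl.
Qed.

Lemma twist_actK1 i a : act (K i) a = c i *: (K i * a * (K i)^-1).
Proof. by rewrite -[K i in LHS]mulr1 twist_actK twist_act1. Qed.

Lemma twist_actx1 i a : act (x i) a = (c i *: (x i * a) - a * x i) * (K i)^-1.
Proof. by rewrite -[x i in LHS]mulr1 twist_actx twist_act1. Qed.

Lemma twist_actM g h a : act (g * h) a = act g (act h a).
Proof.
move: g; apply: (sg_ind gen) => [d u v hu hv||i g hg|i g hg].
- rewrite mulrDl -scalerAl (twist_act_is_linear_l a) hu hv.
  by rewrite (twist_act_is_linear_l (act h a)).
- by rewrite mul1r twist_act1.
- by rewrite -mulrA !twist_actK hg.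
by rewrite -mulrA !twist_actx hg.
Qed.

(** The compatibility of action and coaction of a Yetter-Drinfeld module, for the
generators. *)
Lemma rslice_twistK p i a :
  rslice p (act (K i) a) = act (K i) (rslice (pull_l (pull_r p (K i)^-1) (K i)) a).
Proof.
rewrite !twist_actK1 linearZ /= rslice_KVr (rsliceGl _ _ (sg_comulK gen i)).
by [].
Qed.

Lemma rslice_twistx p i a :
  rslice p (act (x i) a) = act (x i) (rslice (pull_r p (K i)^-1) a)
    + act (K i) (rslice (pull_l (pull_r p (K i)^-1) (x i)) a)
    - rslice (pull_r p (x i * (K i)^-1)) a.
Proof.
have uK := sg_unit gen i; have cx := sg_comulx gen i.
rewrite !twist_actK1 !twist_actx1 rslice_KVr linearB linearZ /= (rsliceSl _ _ cx) (rsliceSr _ _ cx).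
rewrite scalerDr opprD addrACA mulrDl -[RHS]addrA; congr (_ + _).
by rewrite mulrBl mulrK // -scalerAl pull_rr.
Qed.

(** The same compatibility solved for K_i . (p . a) and x_i . (p . a): the left-hand
sides are the products of D(H) that express h p through elements p' h'. *)
Lemma twist_rslice_K p i a :
  rslice (pull_l (pull_r p (K i)) (K i)^-1) (act (K i) a) = act (K i) (rslice p a).
Proof.
have uK := sg_unit gen i.
rewrite rslice_twistK; congr (act _ _); apply: eq_rslice => y.
by rewrite !(pull_lE, pull_rE) -!mulrA mulKr // mulVr // mulr1.
Qed.

Lemma twist_rslice_x p i a :
  rslice (pull_r p (x i)) a + rslice (pull_r p (K i)) (act (x i) a)
    + rslice (pull_l (pull_r p (K i)) (SV (x i))) (act (K i) a)
  = act (x i) (rslice p a).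
Proof.
have uK := sg_unit gen i.
rewrite rslice_twistK rslice_twistx !pull_rr mulVr // mulrVK //.
have -> : pull_r p 1 = p by apply/lfunP => y; rewrite pull_rE mulr1.
rewrite subrKC -addrA -[RHS]addr0; congr (_ + _).
have aL := linear_fun (twist_act_is_linear_r (K i)).
have -> : rslice (pull_l (pull_r (pull_l (pull_r p (K i)) (SV (x i))) (K i)^-1) (K i)) a
    = - rslice (pull_l p (x i)) a.
  rewrite -rsliceNl; apply: eq_rslice => y; rewrite opp_lfunE !(pull_lE, pull_rE).
  rewrite antipodeV_x mulNr mulNr linearN /= !mulrA.
  by rewrite !mulrVK.
by case: aL => _ _ _ ->; rewrite subrr.
Qed.

Local Notation yd := (yd_double_act act (@comul k H)).

Lemma yd_tens p h a : yd (p (x) h) a = rslice p (act h a).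
Proof.
rewrite /yd_double_act sweedler_tens ?rsliceE // => u d v w.
  by rewrite -!rsliceE rslicePl.
by rewrite -!rsliceE (twist_act_is_linear_l a) linearP.
Qed.

Lemma yd_is_linear_l a : linear (yd^~ a).
Proof. exact: sweedler_is_linear. Qed.

Lemma yd_is_linear_r d : linear (yd d).
Proof.
move=> e u v; rewrite /yd_double_act -sweedlerPr; apply: eq_sweedler => p h.
by rewrite -!rsliceE (twist_act_is_linear_r h) linearP.
Qed.

Lemma hdual_mul_counitl p : hdual_mul counit p = p.
Proof. by apply/lfunP => h; rewrite hdual_mul_lslice lslice_counit. Qed.
Lemma hdual_mul_counitr p : hdual_mul p counit = p.
Proof. by apply/lfunP => h; rewrite hdual_mul_rslice rslice_counit. Qed.

(** H with the twisted action satisfies the straightening relation of D(H) between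
h and p.  Since D(H) is spanned by products p h, this is what makes the action
multiplicative. *)
Lemma yd_cross p g a :
  yd (double_mul ((counit : hdual H) (x) g) (p (x) (1 : H))) a = act g (rslice p a).
Proof.
pose T p (h1 h2 h3 : H) := rslice (pull_l (pull_r p h1) (SV h3)) (act h2 a).
have TL q : trilin (T q).
  rewrite /T; split=> u v d b b' /=.
  - by rewrite pull_rPr pull_lPl rslicePl.
  - by rewrite (twist_act_is_linear_l a) linearP.
  by rewrite linearP pull_lPr rslicePl.
transitivity (sweedler3 g (T p)).
  rewrite double_mul_tens /sweedler3 (sweedler_fun _ _ (yd_is_linear_l a)).
  apply: eq_sweedler => u w; rewrite (sweedler_fun _ _ (yd_is_linear_l a)).
  by apply: eq_sweedler => v v'; rewrite yd_tens hdual_mul_counitl mulr1.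
have out g' h q : sweedler3 g' (fun h1 h2 h3 => act h (T q h1 h2 h3)) =
    act h (sweedler3 g' (T q)).
  rewrite /sweedler3 (sweedler_fun _ _ (twist_act_is_linear_r h)).
  by apply: eq_sweedler => u w; rewrite (sweedler_fun _ _ (twist_act_is_linear_r h)).
move: g p; apply: (sg_ind gen) => [d u v hu hv p||i h ih p|i h ih p].
- by rewrite sweedler3_is_linear hu hv (twist_act_is_linear_l (rslice p a)).
- move=> p; rewrite sweedler3_1 // /T !twist_act1 antipodeV1; apply: eq_rslice => y.
  by rewrite pull_lE pull_rE mul1r mulr1.
- rewrite (sweedler3_G _ (sg_comulK gen i)) // twist_actM -ih -out.
  apply: eq_sweedler3 => h1 h2 h3; rewrite /T twist_actM -twist_rslice_K.
  apply: eq_rslice => y; rewrite !(pull_lE, pull_rE) antipodeVM antipodeV_K.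
  by rewrite !mulrA.
rewrite (sweedler3_S _ (sg_comulK gen i) (sg_comulx gen i)) // twist_actM -ih -out.
rewrite -!sweedler3Dr; apply: eq_sweedler3 => h1 h2 h3; rewrite /T !twist_actM.
rewrite -twist_rslice_x; congr (_ + _ + _); apply: eq_rslice => y;
  by rewrite !(pull_lE, pull_rE) ?antipodeVM !mulrA.
Qed.

(** The antipode of D(H) reverses p h, which leaves a product in the wrong order for
[yd_cross] to straighten. *)
Lemma yd_antipode p h a :
  yd (double_antipode (p (x) h)) a = act (S h) (rslice (dual_antipodeV p) a).
Proof. by rewrite double_antipode_tens yd_cross. Qed.

End Twist.
End SkewGeneratedTheory.

(** * Modules over the double and coinduction *)
Section DoubleModules.
Variables (k : fieldType) (H : hopfAlgType k) (I : Type) (K x : I -> H).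
Hypothesis gen : skew_generated K x.
Implicit Types (g h : H) (p : hdual H) (i : I).

Local Notation S := (@antipode k H).
Local Notation SV := (antipodeV H).
Local Notation eps := (counit : hdual H).

Lemma functional_sep (U : vectType k) (a b : U) :
  (forall p : 'Hom(U, k^o), p a = p b) -> a = b.
Proof.
move=> e; apply: (can_inj v2rK); apply/rowP => i.
by have := e (bcovec i); rewrite !bcovecE.
Qed.

Lemma hdual_expand p : p = \sum_i (p (bvec i) : k) *: bcovec i.
Proof.
apply/lfunP => h; rewrite [in LHS](bvec_expand h) linear_sum sum_lfunE.
apply: eq_bigr => i _; rewrite linearZ scale_lfunE /= bcovecE; exact: mulrC.
Qed.

Lemma double_mul_p1 p p' :
  double_mul (p (x) (1 : H)) (p' (x) (1 : H)) = hdual_mul p p' (x) (1 : H).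
Proof.
rewrite double_mul_tens sweedler3_1; last exact: double_kernel_trilin.
rewrite /double_kernel mulr1 (antipodeV1 gen); congr (hdual_mul p _ (x) _).
by apply/lfunP => h; rewrite pull_lE pull_rE mul1r mulr1.
Qed.

Lemma double_mul_ph p h : double_mul (p (x) (1 : H)) (eps (x) h) = p (x) h.
Proof.
rewrite double_mul_tens sweedler3_1; last exact: double_kernel_trilin.
rewrite /double_kernel mul1r (antipodeV1 gen).
have -> : pull_l (pull_r eps 1) 1 = eps.
  by apply/lfunP => y; rewrite pull_lE pull_rE mul1r mulr1.
by rewrite hdual_mul_counitr.
Qed.

Lemma double_mul_1h g h : double_mul (eps (x) g) (eps (x) h) = eps (x) (g * h).
Proof.
rewrite double_mul_tens.
transitivity (sweedler3 g (fun h1 h2 h3 =>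
    (counit h3 : k) *: (eps (x) (((counit h1 : k) *: h2) * h)))).
  apply: eq_sweedler3 => h1 h2 h3; rewrite /double_kernel hdual_mul_counitl.
  rewrite -scalerAl tensZr scalerA.
  have -> : pull_l (pull_r eps h1) (SV h3) = ((counit h3 : k) * (counit h1 : k)) *: eps.
    apply/lfunP => y; rewrite pull_lE pull_rE !counitM (counit_antipodeV gen) scale_lfunE.
    by rewrite -mulrA [X in _ * X]mulrC mulrA.
  by rewrite tensZl.
rewrite /sweedler3 -[in RHS](counitr g).
rewrite (sweedler_fun _ _ (f := fun y => eps (x) (y * h))).
  apply: eq_sweedler => ab c; rewrite sweedlerZr -scalerAl.
  have tL : linear (fun y => eps (x) (y * h)).
    by move=> d u v; rewrite mulrDl -scalerAl tensPr.
  rewrite tensZr; congr (_ *: _).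
  by rewrite -[in RHS](counitl ab) (sweedler_fun _ _ tL).
by move=> d u v; rewrite mulrDl -scalerAl tensPr.
Qed.

Lemma double_mul_Kp i p : double_mul (eps (x) K i) (p (x) (1 : H)) =
  pull_l (pull_r p (K i)) (K i)^-1 (x) K i.
Proof.
rewrite double_mul_tens -[X in sweedler3 X _]mulr1.
have tri := double_kernel_trilin eps (K i) p 1.
rewrite (sweedler3_G _ (sg_comulK gen i)) // sweedler3_1; last first.
  by case: tri => t1 t2 t3; split=> u v c a b; rewrite mulrDr -scalerAr;
     [rewrite t1|rewrite t2|rewrite t3].
by rewrite /double_kernel !mulr1 hdual_mul_counitl (antipodeV_K gen).
Qed.

Lemma double_mul_xp i p : double_mul (eps (x) x i) (p (x) (1 : H)) =
  pull_r p (x i) (x) (1 : H) + pull_r p (K i) (x) x i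
    + pull_l (pull_r p (K i)) (SV (x i)) (x) K i.
Proof.
rewrite double_mul_tens -[X in sweedler3 X _]mulr1.
have tri := double_kernel_trilin eps (x i) p 1.
have [t1 t2 t3] := tri.
have triM a b c : trilin (fun u v w => double_kernel eps (x i) p 1 (a * u) (b * v) (c * w)).
  by split=> u v d y z; rewrite mulrDr -scalerAr; [rewrite t1|rewrite t2|rewrite t3].
rewrite (sweedler3_S _ (sg_comulK gen i) (sg_comulx gen i)) //.
have e a b c T : (forall u v w, T u v w = double_kernel eps (x i) p 1 (a * u) (b * v) (c * w))
    -> sweedler3 1 T = double_kernel eps (x i) p 1 a b c.
  move=> eT; rewrite (eq_sweedler3 _ eT) sweedler3_1 ?mulr1 //.
rewrite (e (x i) 1 1) => [|u v w]; last by rewrite !mul1r.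
rewrite (e (K i) (x i) 1) => [|u v w]; last by rewrite !mul1r.
rewrite (e (K i) (K i) (x i)) // /double_kernel !mulr1 !hdual_mul_counitl (antipodeV1 gen).
by congr (_ (x) _ + _ (x) _ + _); apply/lfunP => y; rewrite !(pull_lE, pull_rE) mul1r.
Qed.

Section Coinduced.
Variables (chi : hdual H) (c : I -> k).
Hypothesis chiP : is_character K x chi c.
Local Notation act := (twist_act chi).
Local Notation yd := (yd_double_act act (@comul k H)).

Variables (M : vectType k) (actM : drinfeld_double H -> M -> M).
Hypothesis modM : is_double_module actM.
Variable phi : 'Hom(M, k^o).
Hypothesis phiK : forall i m, (phi (actM (eps (x) K i) m) : k) = c i * (phi m : k).
Hypothesis phix : forall i m, phi (actM (eps (x) x i) m) = 0.

(** The map m |-> phi(m_(0)) m_(1), where the coaction of M is the one dual to its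
H^*-action.  It is characterized by [coind_mapP]. *)
Definition coind_map : 'Hom(M, H) :=
  linfun (fun m => \sum_i (phi (actM (bcovec i (x) (1 : H)) m) : k) *: bvec i).

Lemma actMl m : linear (actM^~ m). Proof. by case: modM => e _ _ _ d u v; exact: e. Qed.
Lemma actMr d : linear (actM d). Proof. by case: modM => _ e _ _ a u v; exact: e. Qed.
Lemma actM_mul d d' m : actM (double_mul d d') m = actM d (actM d' m).
Proof. by case: modM. Qed.

Lemma coind_mapP p m : p (coind_map m) = phi (actM (p (x) (1 : H)) m).
Proof.
rewrite linfunE.
  have L : linear (fun r : hdual H => phi (actM (r (x) (1 : H)) m)).
    by move=> a u v; rewrite tensPl actMl linearP.
  pose L1 := GRing.isLinear.Build k _ _ _ _ L.
  pose L2 : {linear _ -> _} :=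
    HB.pack (fun r : hdual H => phi (actM (r (x) (1 : H)) m)) L1.
  rewrite -[RHS]/(L2 p) [in RHS](hdual_expand p) !linear_sum.
  by apply: eq_bigr => i _; rewrite linearZ [RHS]linearZ; exact: mulrC.
move=> a u v; rewrite scaler_sumr -big_split; apply: eq_bigr => i _ /=.
by rewrite actMr linearP scalerDl scalerA.
Qed.

Lemma counit_coind_map m : counit (coind_map m) = phi m.
Proof. by rewrite coind_mapP; case: modM => _ _ + _; rewrite /double_one => ->. Qed.

Lemma coind_map_p p m : coind_map (actM (p (x) (1 : H)) m) = rslice p (coind_map m).
Proof.
apply: functional_sep => p'.
by rewrite coind_mapP -actM_mul double_mul_p1 -hdual_mul_rslice coind_mapP.
Qed.

Lemma coind_mapPK p i m : phi (actM (p (x) K i) m) = p (act (K i) (coind_map m)).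
Proof.
have uK := sg_unit gen i.
pose p' := pull_l (pull_r p (K i)^-1) (K i).
have -> : p (x) K i = double_mul (eps (x) K i) (p' (x) (1 : H)).
  rewrite double_mul_Kp; congr (_ (x) _); apply/lfunP => y.
  by rewrite !(pull_lE, pull_rE) !mulrA mulrV // mul1r mulrK.
rewrite actM_mul phiK -coind_mapP (twist_actK1 gen chiP) linearZ /=.
by rewrite pull_lE pull_rE.
Qed.

Lemma coind_map_K i m : coind_map (actM (eps (x) K i) m) = act (K i) (coind_map m).
Proof.
by apply: functional_sep => p; rewrite coind_mapP -actM_mul double_mul_ph coind_mapPK.
Qed.

Lemma coind_map_x i m : coind_map (actM (eps (x) x i) m) = act (x i) (coind_map m).
Proof.
have uK := sg_unit gen i.
apply: functional_sep => p; rewrite coind_mapP -actM_mul double_mul_ph.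
have := phix i (actM (pull_r p (K i)^-1 (x) (1 : H)) m).
rewrite -actM_mul double_mul_xp.
have [_ aD _ _] := linear_fun (actMl m); rewrite !aD !linearD /=.
rewrite pull_rr -coind_mapP coind_mapPK.
have -> : pull_r (pull_r p (K i)^-1) (K i) = p.
  by apply/lfunP => y; rewrite !pull_rE mulrK.
rewrite pull_lE pull_rE (antipodeV_x gen) (twist_actK1 gen chiP) (twist_actx1 gen chiP).
rewrite addrAC => /(canRL (addKr _)) ->; rewrite addr0.
rewrite mulNr linearN /= opprD opprK addrC mulrBl linearB /=.
by rewrite -!scalerAr -!scalerAl -!mulrA mulKr.
Qed.

(** Coinduction: functionals on M with H-character chi correspond to D(H)-maps from
M to H with the action twisted by chi.  Compatibility with H^* is the definition of the
coaction; compatibility with H comes from the straightening relations for the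
generators. *)
Lemma coind_map_morph d m : coind_map (actM d m) = yd d (coind_map m).
Proof.
elim/tensor_ind: d m => [a t t' ht ht' m|p h m].
  by rewrite actMl linearP /= ht ht' (yd_is_linear_l _ (coind_map m)).
rewrite yd_tens -double_mul_ph actM_mul coind_map_p; congr (rslice p _).
move: h m; apply: (sg_ind gen) => [a u v hu hv m||i h ih m|i h ih m].
- by rewrite tensPr actMl linearP /= hu hv (twist_act_is_linear_l _ (coind_map m)).
- by move=> m; rewrite (twist_act1 gen chiP); case: modM => _ _ -> _.
- by rewrite -double_mul_1h actM_mul coind_map_K ih (twist_actM gen chiP).
by rewrite -double_mul_1h actM_mul coind_map_x ih (twist_actM gen chiP).
Qed.

End Coinduced.
End DoubleModules.

(** * The module generated by a group-like *)
Section CyclicSubmodules.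
Variables (k : fieldType) (H : hopfAlgType k) (I : Type) (K x : I -> H).
Hypothesis gen : skew_generated K x.
Implicit Types (g h : H) (p : hdual H) (i : I).

Local Notation S := (@antipode k H).
Local Notation SV := (antipodeV H).
Local Notation eps := (counit : hdual H).
Local Notation yd chi := (yd_double_act (twist_act chi) (@comul k H)).

Definition cyclic_submod (chi : hdual H) (b : H) : {vspace H} :=
  limg (linfun (fun h : H => twist_act chi h b)).

Definition cyclic_act (chi : hdual H) (b : H) :=
  sub_act (V := cyclic_submod chi b) (yd chi).

Section OneModule.
Variables (chi : hdual H) (c : I -> k) (b : H).
Hypothesis chiP : is_character K x chi c.
Hypothesis bb : comul b = b (x) b.
Local Notation act := (twist_act chi).
Local Notation V := (cyclic_submod chi b).

Lemma cyclicP a : reflect (exists h, a = act h b) (a \in V).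
Proof.
apply: (iffP memv_imgP) => [[h _ ->]|[h ->]]; exists h; rewrite ?memvf //;
  by rewrite linfunE //; exact: twist_act_is_linear_l.
Qed.

Lemma cyclic_gen : b \in V.
Proof. by apply/cyclicP; exists 1; rewrite (twist_act1 gen chiP). Qed.

Lemma cyclic_act_stable h a : a \in V -> act h a \in V.
Proof.
by case/cyclicP=> g ->; apply/cyclicP; exists (h * g); rewrite (twist_actM gen chiP).
Qed.

Lemma rslice_gl p : rslice p b = (p b : k) *: b.
Proof.
rewrite rsliceE bb sweedler_tens // => u; first by case: (bilin_scale_r p).
by case: (bilin_scale_r p).
Qed.

Lemma lslice_gl p : lslice p b = (p b : k) *: b.
Proof.
rewrite lsliceE bb sweedler_tens // => u; first by case: (bilin_scale_l p).
by case: (bilin_scale_l p).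
Qed.

(** A submodule generated by a group-like is a subcomodule: moving a slice past a
generator only produces further slices of the same vector. *)
Lemma cyclic_rslice_stable p a : a \in V -> rslice p a \in V.
Proof.
case/cyclicP=> h ->{a}.
have VK i a := @cyclic_act_stable (K i) a; have Vx i a := @cyclic_act_stable (x i) a.
move: h p; apply: (sg_ind gen) => [d u v hu hv p||i h ih p|i h ih p].
- by rewrite (twist_act_is_linear_l _ b) linearP memvD ?memvZ ?hu ?hv.
- by move=> p; rewrite (twist_act1 gen chiP) rslice_gl memvZ ?cyclic_gen.
- by rewrite (twist_actM gen chiP) (rslice_twistK gen chiP) VK.
rewrite (twist_actM gen chiP) (rslice_twistx gen chiP) memvB //.
by rewrite memvD ?Vx ?VK.
Qed.

Lemma cyclic_yd_stable d a : a \in V -> yd chi d a \in V.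
Proof.
move=> Va; elim/tensor_ind: d => [e t t' ht ht'|p h].
  by rewrite (yd_is_linear_l _ a) memvD ?memvZ.
by rewrite yd_tens cyclic_rslice_stable // cyclic_act_stable.
Qed.

Lemma cyclic_actE d (w : subvs_of V) : vsval (cyclic_act d w) = yd chi d (vsval w).
Proof. by rewrite /cyclic_act /sub_act vsprojK // cyclic_yd_stable ?subvsP. Qed.

Lemma cyclic_act_is_linear_l w : linear (@cyclic_act chi b ^~ w).
Proof. by move=> e t t'; rewrite /cyclic_act /sub_act (yd_is_linear_l chi) linearP. Qed.

Lemma cyclic_act_is_linear_r d : linear (@cyclic_act chi b d).
Proof.
by move=> e u v; rewrite /cyclic_act /sub_act linearP (yd_is_linear_r chi) linearP.
Qed.

(** By irreducibility f is injective, and the preimage of the submodule generated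
by b is all of M. *)
Lemma irreducible_cyclic (M : vectType k) (actM : drinfeld_double H -> M -> M)
    (f : 'Hom(M, H)) m0 :
  is_double_module actM -> is_irreducible actM ->
  (forall d m, f (actM d m) = yd chi d (f m)) -> f m0 = b -> b != 0 ->
  double_iso actM (@cyclic_act chi b).
Proof.
move=> [aL1 aL2 _ _] [_ irr] fL fm0 b0.
have aL0 d : actM d 0 = 0 by case: (linear_fun (fun c u v => aL2 c d u v)).
have fker : lker f = 0%VS.
  case: (irr (lker f)) => [d w||] //.
    rewrite !memv_ker fL => /eqP->; apply/eqP.
    by case: (linear_fun (yd_is_linear_r chi d)).
  by move/vspaceP/(_ m0); rewrite memvf memv_ker fm0 (negPf b0).
have fV m : f m \in V.
  have: m \in (f @^-1: V)%VS.
    case: (irr (f @^-1: V)%VS) => [d w||->].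
    - by rewrite -!memv_preim fL; exact: cyclic_yd_stable.
    - move/vspaceP/(_ m0); rewrite -(memv_preim f m0 V) fm0 cyclic_gen memv0.
      by move/esym/eqP => e; rewrite e linear0 in fm0; rewrite -fm0 eqxx in b0.
    exact: memvf.
  by rewrite -memv_preim.
have finj : injective f by apply/lker0P; rewrite fker.
have gL : linear (fun m => vsproj V (f m)) by move=> a u v; rewrite !linearP.
exists (linfun (fun m => vsproj V (f m))); last first.
  move=> d m; rewrite !(linfunE gL) fL; apply: val_inj; rewrite /= cyclic_actE.
  by rewrite !vsprojK ?cyclic_yd_stable // -fL fV.
pose F (w : subvs_of V) := (f^-1)%VF (vsval w).
have Vf w : vsval (w : subvs_of V) \in limg f.
  have /cyclicP[h ->] := subvsP w.
  rewrite -fm0; have -> : twist_act chi h (f m0) = f (actM (eps (x) h) m0).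
    by rewrite fL yd_tens rslice_counit.
  by rewrite memv_img ?memvf.
exists F => [m|w]; rewrite (linfunE gL) /F.
  by rewrite vsprojK // lker0_lfunK ?fker.
by rewrite limg_lfunVK // vsvalK.
Qed.

End OneModule.

(** A vector w whose coaction is w (x) b is a multiple of b, as one sees by applying
the counit.  An isomorphism preserves coactions and weights, so it sends the
line of b to itself, and its K_i-weights c_i are the same on both sides. *)
Lemma cyclic_iso_inv chi chi' c c' (b b' : H) :
  is_character K x chi c -> is_character K x chi' c' ->
  comul b = b (x) b -> comul b' = b' (x) b' -> b != 0 ->
  (forall i, K i * b = b * K i) ->
  double_iso (@cyclic_act chi b) (@cyclic_act chi' b') ->
  b \in cyclic_submod chi' b' /\ c =1 c'.
Proof.
move=> chiP chiP' bb bb' b0 Kb [f [g fK gK] fL].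
have Vb := cyclic_gen b chiP.
pose w := vsval (f (vsproj _ b)).
have fb d : yd chi' d w = vsval (f (cyclic_act d (vsproj _ b))).
  by rewrite fL (cyclic_actE chiP' bb').
have eb d : cyclic_act d (vsproj _ b) = vsproj (cyclic_submod chi b) (yd chi d b).
  by rewrite /cyclic_act /sub_act vsprojK.
have w0 : w != 0.
  apply: contraNneq b0 => e.
  have fz : f (vsproj _ b) = 0 by apply: val_inj.
  have : vsproj (cyclic_submod chi b) b = 0.
    by apply: (can_inj fK); rewrite fz linear0.
  by move/(congr1 vsval); rewrite vsprojK // => ->; rewrite linear0.
have wE : w = (counit w : k) *: b.
  apply: functional_sep => p; rewrite linearZ /=.
  have e : rslice p w = (p b : k) *: w.
    have := fb (p (x) (1 : H)); rewrite yd_tens (twist_act1 gen chiP') => ->.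
    by rewrite eb yd_tens (twist_act1 gen chiP) (rslice_gl bb) !linearZ.
  have := congr1 (fun a => counit a : k) e; rewrite linearZ /=.
  rewrite -hdual_mul_rslice hdual_mul_counitl => ->; exact: mulrC.
have Vw : w \in cyclic_submod chi' b' by exact: subvsP.
have cw0 : (counit w : k) != 0 by apply: contraNneq w0 => e; rewrite wE e scale0r.
split.
  have -> : b = (counit w : k)^-1 *: w by rewrite [X in _ *: X]wE scalerA mulVf ?scale1r.
  exact: memvZ.
move=> i; have := fb (eps (x) K i).
rewrite yd_tens rslice_counit eb yd_tens rslice_counit.
rewrite (twist_actK1 gen chiP) (twist_actK1 gen chiP') Kb mulrK ?(sg_unit gen) //.
rewrite !linearZ /= -/w {1}wE -scalerAr Kb -scalerAl mulrK ?(sg_unit gen) // -wE.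
move/eqP; rewrite -subr_eq0 -scalerBl scaler_eq0 (negPf w0) orbF subr_eq0.
by move/eqP->.
Qed.

End CyclicSubmodules.

(** * Criteria for self-duality *)
Section SelfDual.
Variables (k : fieldType) (H : hopfAlgType k) (I : Type) (K x : I -> H).
Hypothesis gen : skew_generated K x.
Implicit Types (g h : H) (p : hdual H) (i : I).

Local Notation S := (@antipode k H).
Local Notation SV := (antipodeV H).
Local Notation eps := (counit : hdual H).

Variables (chi : hdual H) (c : I -> k) (b : H).
Hypothesis chiP : is_character K x chi c.
Hypothesis bb : comul b = b (x) b.
Local Notation act := (twist_act chi).
Local Notation yd := (yd_double_act act (@comul k H)).
Local Notation V := (cyclic_submod chi b).
Local Notation cact := (@cyclic_act k H chi b).
Local Notation proj := (vsproj V).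

Lemma dual_actE d (f : 'Hom(subvs_of V, k^o)) w :
  dual_act cact d f w = f (cact (double_antipode d) w).
Proof.
rewrite linfunE // => e u u'.
by rewrite cyclic_act_is_linear_r linearP.
Qed.

Lemma cact_antipode p h a : a \in V ->
  cact (double_antipode (p (x) h)) (proj a) =
  proj (act (S h) (rslice (dual_antipodeV p) a)).
Proof.
by move=> Va; rewrite /cyclic_act /sub_act vsprojK // (yd_antipode gen chiP).
Qed.

Section Extremal.
Variables (v : H) (d : I -> k).
Hypothesis Vv : v \in V.
Hypothesis vx : forall i, act (x i) v = 0.
Hypothesis vK : forall i, act (K i) v = d i *: v.

Lemma twist_act_linear h : [/\ act h 0 = 0, forall u u', act h (u + u') = act h u + act h u',
  forall e u, act h (e *: u) = e *: act h u & forall u, act h (- u) = - act h u].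
Proof. by have [] := linear_fun (@twist_act_is_linear_r k H chi h). Qed.

Lemma twist_actN h a : act (- h) a = - act h a.
Proof. by have [_ _ _ ->] := linear_fun (@twist_act_is_linear_l k H chi a). Qed.

Lemma act_KVK i a : act (K i)^-1 (act (K i) a) = a.
Proof.
by rewrite -(twist_actM gen chiP) mulVr ?(sg_unit gen) // (twist_act1 gen chiP).
Qed.

Lemma act_Sx i a : act (S (x i)) a = - act (K i)^-1 (act (x i) a).
Proof. by rewrite (sg_antipodex gen) twist_actN (twist_actM gen chiP). Qed.

Lemma act_S_extremal h : v != 0 -> exists e, act (S h) v = e *: v.
Proof.
move=> v0; move: h; apply: (sg_ind gen) => [e u u' [r hr] [r' hr']||i h [r hr]|i h [r hr]].
- exists (e * r + r').
  by rewrite linearP (twist_act_is_linear_l _ v) hr hr' scalerDl scalerA.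
- by exists 1; rewrite antipode1 (twist_act1 gen chiP) scale1r.
- have [_ _ aZ _] := twist_act_linear (K i)^-1.
  have e := act_KVK i v; rewrite vK aZ in e.
  have d0 : d i != 0 by apply: contraNneq v0 => d0; rewrite -e d0 scale0r.
  exists ((d i)^-1 * r).
  have -> : act (S (K i * h)) v = act (S h) (act (K i)^-1 v).
    by rewrite (antipode_Kl gen) (twist_actM gen chiP).
  have -> : act (K i)^-1 v = (d i)^-1 *: v by rewrite -[in RHS]e scalerA mulVf ?scale1r.
  by have [_ _ -> _] := twist_act_linear (S h); rewrite hr scalerA.
exists 0; rewrite (antipode_xl gen) (twist_actM gen chiP) act_Sx vx scale0r.
have [-> _ _ _] := twist_act_linear (K i)^-1.
by rewrite oppr0; have [-> _ _ _] := twist_act_linear (S h).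
Qed.

(** Read F as an invariant form.  If it vanished on (b, v), it would vanish on
(h b, v) for all h, because S h maps v to a multiple of v; but the h b exhaust the
module, so v would be zero.  Hence p acts on b by the scalar by which its antipode acts
on v. *)
Lemma self_dual_weight p r : v != 0 -> self_dual cact ->
  rslice (dual_antipodeV p) v = r *: v -> p b = r.
Proof.
move=> v0 [F [G FK GK] FL] pv.
have Vb := cyclic_gen gen b chiP.
have inv q h m : F (cact (q (x) h) m) (proj v) =
    F m (proj (act (S h) (rslice (dual_antipodeV q) v))).
  by rewrite FL dual_actE cact_antipode.
have Fbv : F (proj b) (proj v) != 0.
  apply/negP => /eqP Fbv.
  have F0 m : F m (proj v) = 0.
    have /(cyclicP _ _)[h mh] := subvsP m.
    have -> : m = cact (eps (x) h) (proj b).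
      apply: val_inj; rewrite /= (cyclic_actE gen chiP bb) vsprojK // yd_tens.
      by rewrite rslice_counit -mh.
    rewrite inv (dual_antipodeV_counit gen) rslice_counit.
    have [e ->] := act_S_extremal h v0.
    by rewrite !linearZ /= Fbv scaler0.
  have pv0 : proj v = 0.
    by apply: functional_sep => f; rewrite linear0 -[f]GK F0.
  move: v0; rewrite -[v](vsprojK Vv) pv0.
  by rewrite linear0 eqxx.
apply: (mulIf Fbv).
have := inv p 1 (proj b).
rewrite antipode1 (twist_act1 gen chiP) pv.
have -> : cact (p (x) (1 : H)) (proj b) = (p b : k) *: proj b.
  by rewrite /cyclic_act /sub_act vsprojK // yd_tens (twist_act1 gen chiP) (rslice_gl bb) linearZ.
by rewrite !linearZ /= scale_lfunE.
Qed.

(** The coinduced map of the dual module at the functional evaluation at v: the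
coaction of the dual involves S^-1.  It is defined on functionals on all of H,
and [eq_dual_coind] shows that it only depends on their restriction to V. *)
Definition dual_coind (f : hdual H) : H := SV (lslice f v).

Lemma rslice_dual_coind p f :
  rslice p (dual_coind f) = dual_coind (f \o rslice (dual_antipodeV p))%VF.
Proof.
rewrite /dual_coind (rslice_antipodeV gen) lslice_mul; congr (SV _).
by apply: eq_lslice => a; rewrite hdual_mul_rslice lfunE.
Qed.

Definition twist_lfun h : 'End(H) := linfun (act h).
Lemma twist_lfunE h a : twist_lfun h a = act h a.
Proof. by rewrite linfunE //; exact: twist_act_is_linear_r. Qed.

Lemma lslice_KVr p i h :
  lslice p (h * (K i)^-1) = lslice (pull_r p (K i)^-1) h * (K i)^-1.
Proof.
have uK := sg_unit gen i.
rewrite -[in RHS](mulrVK uK h) (lsliceGr _ _ (sg_comulK gen i)) mulrK //.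
by apply: eq_lslice => a; rewrite !pull_rE mulrK.
Qed.

Lemma lslice_twistK f i :
  lslice f (act (K i) v) = K i * lslice (f \o twist_lfun (K i))%VF v * (K i)^-1.
Proof.
rewrite (twist_actK1 gen chiP) linearZ /= lslice_KVr (lsliceGl _ _ (sg_comulK gen i)).
rewrite scalerAl scalerAr; congr (_ * _ * _).
rewrite !lsliceE -sweedlerZr; apply: eq_sweedler => a a'; rewrite scalerA.
by rewrite pull_lE pull_rE lfunE /= twist_lfunE (twist_actK1 gen chiP) linearZ.
Qed.

(** Slicing the vector x_i v, which is zero for an extremal v, relates the slices of
v along f, f x_i and f K_i. *)
Lemma lslice_twistx f i :
  lslice f (act (x i) v) = (lslice (f \o twist_lfun (x i))%VF v
    + x i * lslice (f \o twist_lfun (K i))%VF v - lslice f v * x i) * (K i)^-1.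
Proof.
have uK := sg_unit gen i; have cx := sg_comulx gen i.
rewrite (twist_actx1 gen chiP) lslice_KVr linearB linearZ /=.
rewrite (lsliceSl _ _ cx) (lsliceSr _ _ cx) scalerDr opprD addrACA.
rewrite [X in _ + (_ - X * _)](_ : _ = lslice f v); last first.
  by apply: eq_lslice => a; rewrite !pull_rE mulrK.
rewrite addrA scalerAr.
rewrite [X in (_ + _ * X - _) * _](_ : _ = lslice (f \o twist_lfun (K i))%VF v); last first.
  rewrite !lsliceE -sweedlerZr; apply: eq_sweedler => a a'; rewrite scalerA.
  by rewrite pull_lE pull_rE lfunE /= twist_lfunE (twist_actK1 gen chiP) linearZ.
congr ((_ + _ - _) * _).
rewrite -lsliceNl -lslicePl; apply: eq_lslice => a.
rewrite hdualPl opp_lfunE !(pull_lE, pull_rE).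
rewrite lfunE /= twist_lfunE (twist_actx1 gen chiP) mulrBl linearB -scalerAl linearZ.
by rewrite -!mulrA.
Qed.

(* Evaluation at v has H-character chi: the K_i-weights of v are inverse to c. *)
Hypothesis cd : forall i, c i * d i = 1.

Lemma dual_coind_KV f i :
  lslice (f \o twist_lfun (K i)^-1%R)%VF v = c i *: (K i * lslice f v * (K i)^-1).
Proof.
have := lslice_twistK (f \o twist_lfun (K i)^-1%R)%VF i.
rewrite vK linearZ /= => /(congr1 (fun a => c i *: a)).
rewrite scalerA cd scale1r => ->; congr (_ *: (_ * _ * _)).
by apply: eq_lslice => a; rewrite !lfunE /= !lfunE /= !twist_lfunE act_KVK.
Qed.

Lemma dual_coind_K f i :
  dual_coind (f \o twist_lfun (S (K i)))%VF = act (K i) (dual_coind f).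
Proof.
rewrite /dual_coind (sg_antipodeK gen) dual_coind_KV linearZ /=.
by rewrite !(antipodeVM gen) (antipodeV_K gen) (antipodeV_KV gen) (twist_actK1 gen chiP) mulrA.
Qed.

Lemma dual_coind_x f i :
  dual_coind (f \o twist_lfun (S (x i)))%VF = act (x i) (dual_coind f).
Proof.
have uK := sg_unit gen i.
have := lslice_twistx (f \o twist_lfun (K i)^-1%R)%VF i.
rewrite vx linear0 => /esym/(congr1 (fun a => a * K i)); rewrite mulrVK // mul0r.
have -> : lslice ((f \o twist_lfun (K i)^-1%R) \o twist_lfun (K i))%VF v = lslice f v.
  by apply: eq_lslice => a; rewrite !lfunE /= !lfunE /= !twist_lfunE act_KVK.
rewrite dual_coind_KV => e.
have {e} e : lslice (f \o twist_lfun (S (x i)))%VF v =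
    x i * lslice f v - c i *: (K i * lslice f v * (K i)^-1) * x i.
  have -> : (f \o twist_lfun (S (x i)))%VF = 
      - ((f \o twist_lfun (K i)^-1%R) \o twist_lfun (x i))%VF :> hdual H.
    apply/lfunP => a; rewrite opp_lfunE !lfunE /= !lfunE /= !twist_lfunE.
    by rewrite act_Sx linearN.
  rewrite lsliceNl; apply/eqP; rewrite eq_sym -subr_eq0 opprK.
  by rewrite addrC addrA e.
rewrite /dual_coind e linearB -scalerAl linearZ /= !(antipodeVM gen).
rewrite (antipodeV_K gen) (antipodeV_KV gen) (antipodeV_x gen).
rewrite (twist_actx1 gen chiP) mulrN mulNr scalerN opprK addrC mulrBl.
by rewrite -!mulrA mulKr // -scalerAl !mulrA.
Qed.

Lemma dual_coind_act f h :
  dual_coind (f \o twist_lfun (S h))%VF = act h (dual_coind f).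
Proof.
have lin0 : linear dual_coind by move=> e u u'; rewrite /dual_coind lslicePl linearP.
move: h f; apply: (sg_ind gen) => [e u u' hu hu' f||i h ih f|i h ih f].
- rewrite twist_act_is_linear_l -hu -hu' -lin0; congr dual_coind.
  apply/lfunP => a; rewrite hdualPl !lfunE /= !twist_lfunE linearP /=.
  by rewrite twist_act_is_linear_l linearP.
- move=> f; rewrite (twist_act1 gen chiP); congr dual_coind; apply/lfunP => a.
  by rewrite lfunE /= twist_lfunE antipode1 (twist_act1 gen chiP).
- rewrite (twist_actM gen chiP) -ih -dual_coind_K; congr dual_coind.
  apply/lfunP => a; rewrite !lfunE /= !lfunE /= !twist_lfunE.
  by rewrite -(twist_actM gen chiP) (antipodeM gen).
rewrite (twist_actM gen chiP) -ih -dual_coind_x; congr dual_coind.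
apply/lfunP => a; rewrite !lfunE /= !lfunE /= !twist_lfunE.
by rewrite -(twist_actM gen chiP) (antipodeM gen).
Qed.

Lemma eq_dual_coind (f f' : hdual H) :
  (forall a, a \in V -> f a = f' a) -> dual_coind f = dual_coind f'.
Proof.
move=> e; rewrite /dual_coind; congr (SV _); apply: functional_sep => r.
rewrite -!hdual_mul_lslice !hdual_mul_rslice; apply: e.
exact: (cyclic_rslice_stable gen chiP bb).
Qed.

Definition dual_coind_sub (f : 'Hom(subvs_of V, k^o)) : H :=
  dual_coind (f \o linfun proj)%VF.

Lemma dual_coind_sub_is_linear : linear dual_coind_sub.
Proof.
move=> e u u'; rewrite /dual_coind_sub /dual_coind.
have -> : ((e *: u + u') \o linfun proj)%VF =
   e *: (u \o linfun proj)%VF + (u' \o linfun proj)%VF :> hdual H.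
  by apply/lfunP => a; rewrite hdualPl !lfunE /= !lfunE /= lfunE.
by rewrite lslicePl linearP.
Qed.

Lemma dual_coind_morph e f :
  dual_coind_sub (dual_act cact e f) = yd e (dual_coind_sub f).
Proof.
elim/tensor_ind: e => [r t t' ht ht'|p h].
  rewrite yd_is_linear_l -ht -ht' -dual_coind_sub_is_linear.
  congr dual_coind_sub; apply/lfunP => w.
  rewrite add_lfunE scale_lfunE !dual_actE (double_antipode_is_linear).
  by rewrite cyclic_act_is_linear_l linearP.
rewrite yd_tens -dual_coind_act rslice_dual_coind; apply: eq_dual_coind => a Va.
rewrite lfunE /= dual_actE lfunE /= cact_antipode // !comp_lfunE twist_lfunE.
by congr (f _); rewrite [RHS]lfunE.
Qed.

(** The image of the coinduced map contains b, hence V, and the dual of V has the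
dimension of V; so the map is an isomorphism from the dual onto V. *)
Lemma extremal_self_dual f0 : dual_coind f0 = b -> self_dual cact.
Proof.
move=> f0b; pose G : 'Hom('Hom(subvs_of V, k^o), H) := linfun dual_coind_sub.
have GE f : G f = dual_coind_sub f by rewrite linfunE //; exact: dual_coind_sub_is_linear.
have VG : (V <= limg G)%VS.
  apply/subvP => a /(cyclicP _ _)[h ->].
  pose f1 : 'Hom(subvs_of V, k^o) := (f0 \o linfun vsval)%VF.
  have Gf1 : G f1 = b.
    rewrite GE /dual_coind_sub -[RHS]f0b; apply: eq_dual_coind => a' Va'.
    by rewrite !lfunE /= !lfunE /= lfunE /= vsprojK.
  have -> : act h b = G (dual_act cact (eps (x) h) f1).
    by rewrite GE dual_coind_morph -GE Gf1 yd_tens rslice_counit.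
  by rewrite memv_img ?memvf.
have dimG : \dim (fullv : {vspace 'Hom(subvs_of V, k^o)}) = \dim V.
  by rewrite dimvf /= /dim /= muln1.
have := limg_ker_dim G fullv; rewrite capfv dimG => dG.
have ker0 : lker G = 0%VS.
  apply/eqP; rewrite -dimv_eq0 -leqn0 -(leq_add2r (\dim (limg G))) dG add0n.
  exact: dimvS.
have imG : limg G = V.
  apply/eqP; rewrite eq_sym eqEdim VG /=.
  by rewrite -dG leq_addl.
have Ginj : injective G by apply/lker0P; rewrite ker0.
have FL : linear (fun w : subvs_of V => (G^-1)%VF (vsval w)) by move=> e u u'; rewrite !linearP.
pose F : 'Hom(subvs_of V, 'Hom(subvs_of V, k^o)) := linfun (fun w => (G^-1)%VF (vsval w)).
have FE w : F w = (G^-1)%VF (vsval w) by rewrite linfunE.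
have GF w : G (F w) = vsval w by rewrite FE limg_lfunVK // imG subvsP.
exists F.
  exists (fun f => proj (G f)) => [w|f]; first by rewrite GF vsvalK.
  apply: Ginj; rewrite GF vsprojK //.
  by have := memv_img G (memvf f); rewrite imG.
move=> e w; apply: Ginj.
by rewrite GF (cyclic_actE gen chiP bb) [RHS]GE dual_coind_morph -GE GF.
Qed.

End Extremal.
End SelfDual.

(** * q-commutation, roots of unity and the lattice *)
Section Commutation.
Variables (k : fieldType) (B : unitAlgType k).
Implicit Types (u y : B) (s : k).

Lemma qcommX u y s m : u * y = s *: (y * u) -> u ^+ m * y = s ^+ m *: (y * u ^+ m).
Proof.
move=> e; elim: m => [|m IH]; first by rewrite !expr0 mul1r mulr1 scale1r.
by rewrite [u ^+ _.+1]exprS -mulrA IH -scalerAr [u * (y * _)]mulrA e -scalerAl scalerA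
  -exprSr mulrA.
Qed.

Lemma qcommXz u y s (m : int) : u \is a GRing.unit -> s != 0 ->
  u * y = s *: (y * u) -> u ^ m * y = s ^ m *: (y * u ^ m).
Proof.
move=> uu s0 e; case: m => m; first exact: qcommX.
have uX : u ^+ m.+1 \is a GRing.unit by rewrite unitrX.
apply: (mulrI uX); apply: (mulIr uX); rewrite !NegzE -!exprnN.
rewrite mulVKr // -scalerAr mulrA -!scalerAl mulrVK //.
by rewrite (qcommX _ e) scalerA mulVf ?scale1r // expf_neq0.
Qed.

Lemma qcomm_prod (J : Type) (r : seq J) (F : J -> B) (s : J -> k) y :
  (forall j, F j * y = s j *: (y * F j)) ->
  (\prod_(j <- r) F j) * y = (\prod_(j <- r) s j) *: (y * \prod_(j <- r) F j).
Proof.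
move=> e; elim: r => [|j r IH]; first by rewrite !big_nil mul1r mulr1 scale1r.
rewrite !big_cons -mulrA IH -scalerAr [F j * (y * _)]mulrA e -scalerAl scalerA.
by rewrite mulrC -mulrA.
Qed.

Lemma qcomm_sym u y s : s != 0 -> u * y = s *: (y * u) -> y * u = s^-1 *: (u * y).
Proof. by move=> s0 ->; rewrite scalerA mulVf ?scale1r. Qed.

(** Moving y_i through the earlier factors of an ordered monomial costs a nonzero
scalar. *)
Lemma qcomm_absorb (J : eqType) (r : seq J) (y : J -> B) (s : J -> J -> k)
    (g : J -> nat) i :
  (forall i j, s i j != 0) -> (forall i j, y i * y j = s i j *: (y j * y i)) ->
  uniq r -> i \in r ->
  exists2 d, d != 0 & y i * \prod_(j <- r) y j ^+ g j =
                      d *: \prod_(j <- r) y j ^+ (g j + (j == i)).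
Proof.
move=> s0 e; elim: r => // j r IH /=; rewrite !big_cons.
case/andP=> jr ur; rewrite in_cons => /predU1P[ij|ir].
  exists 1; first exact: oner_neq0.
  rewrite scale1r mulrA -ij eqxx addn1 exprS; congr (_ * _).
  rewrite ij; apply: eq_big_seq => l lr.
  by rewrite (negPf (memPn jr l lr)) addn0.
have [d d0 eIH] := IH ur ir.
have ji : (j == i) = false by apply: contraNF jr => /eqP->.
have := qcommX (g j) (e j i) => /qcomm_sym; rewrite expf_neq0 // => /(_ isT) ej.
exists ((s j i ^+ g j)^-1 * d); first by rewrite mulf_neq0 ?invr_neq0 ?expf_neq0.
by rewrite mulrA ej -scalerAl -mulrA eIH ji addn0 -scalerAr scalerA.
Qed.

End Commutation.

Section PrimitiveRoot.
Variables (k : fieldType) (ell : nat) (q : k).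
Hypothesis prim : ell.-primitive_root q.

Lemma prim_neq0 : q != 0.
Proof.
apply/eqP => q0; have := prim_expr_order prim.
rewrite q0 expr0n eqn0Ngt (prim_order_gt0 prim) /= => /eqP.
by rewrite eq_sym oner_eq0.
Qed.

Lemma prim_exprz_eq1 (m : int) : (q ^ m == 1) = (ell%:Z %| m)%Z.
Proof.
case: m => m; rewrite dvdzE /=; first by rewrite (prim_order_dvd prim).
by rewrite NegzE -exprnN invr_eq1 (prim_order_dvd prim).
Qed.

Lemma prim_exprz_eq (a b : int) : (q ^ a == q ^ b) = (a == b %[mod ell])%Z.
Proof.
rewrite eqz_mod_dvd -prim_exprz_eq1 expfzDr ?prim_neq0 //.
have u : q ^ b != 0 by rewrite expfz_neq0 ?prim_neq0.
rewrite -[RHS](inj_eq (mulIf u)) mul1r -mulrA -expfzDr ?prim_neq0 //.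
by rewrite addNr mulr1.
Qed.

End PrimitiveRoot.

Section LatticeArithmetic.
Variables (n ell : nat).
Implicit Types (i j : 'I_n) (a b al be r : lattice n).

Lemma tilde0 i : tilde (0 : lattice n) i = 0.
Proof. by rewrite ffunE !big1 ?subr0 // => j _; rewrite ffunE. Qed.

Lemma tildeB a b i : tilde (a - b) i = tilde a i - tilde b i.
Proof.
have e (P : pred 'I_n) : \sum_(j | P j) (a - b) j = \sum_(j | P j) a j - \sum_(j | P j) b j.
  by rewrite -sumrB; apply: eq_bigr => j _; rewrite !ffunE.
by rewrite [LHS]ffunE !e [tilde a i]ffunE [tilde b i]ffunE; ring.
Qed.

Lemma tildeN a i : tilde (- a) i = - tilde a i.
Proof. by rewrite -[- a]add0r tildeB tilde0 add0r. Qed.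

Lemma residueP a b : reflect (forall i, (a i = b i %[mod ell])%Z)
  (residue ell a == residue ell b).
Proof.
apply: (iffP eqP) => [/ffunP e i|e]; first by have := e i; rewrite !ffunE.
by apply/ffunP => i; rewrite !ffunE.
Qed.

Lemma residue_box a : in_box ell a -> residue ell a = a.
Proof.
move=> ba; apply/ffunP => i; rewrite ffunE modz_small //.
by have := ba i; lia.
Qed.

Lemma residue_in_box a : (0 < ell)%N -> in_box ell (residue ell a).
Proof.
move=> ell0 i; have e0 : ell%:Z != 0 by rewrite -lt0n.
rewrite ffunE modz_ge0 //=.
have : (a i %% ell%:Z)%Z < ell%:Z by rewrite ltz_pmod.
by lia.
Qed.

Lemma tilde_mod a b i : (forall j, (a j = b j %[mod ell])%Z) ->
  (tilde a i = tilde b i %[mod ell])%Z.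
Proof.
move=> e; apply/eqP; rewrite eqz_mod_dvd -tildeB ffunE.
by apply: rpredB; apply: rpred_sum => j _; rewrite !ffunE -eqz_mod_dvd e.
Qed.

(** As kappa = - tilde be + 2 be - al modulo ell. *)
Lemma kappa_doubleP al be : in_box ell al ->
  (forall i, kappa ell al be i = be i *+ 2 %[mod ell])%Z <->
  al = residue ell (- tilde be).
Proof.
move=> bal; rewrite -[X in X = _]residue_box //.
split=> [e|/eqP/residueP e i]; first (apply/eqP/residueP => i; have {e} := e i).
  rewrite [in kappa _ _ _ _]ffunE modz_mod => /eqP; rewrite eqz_mod_dvd => h.
  apply/eqP; rewrite eq_sym eqz_mod_dvd; move: h; congr (_ %| _)%Z.
  by rewrite !mulr2n [LHS]addrC !ffunE; ring.
rewrite [in kappa _ _ _ _]ffunE modz_mod; apply/eqP; rewrite eqz_mod_dvd.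
have := e i => /eqP; rewrite eq_sym eqz_mod_dvd; congr (_ %| _)%Z.
by rewrite !mulr2n [RHS]addrC !ffunE; ring.
Qed.

Lemma lattice_mulrn r m i : (r *+ m) i = r i * m%:Z.
Proof.
elim: m => [|m IH]; first by rewrite mulr0n ffunE mulr0.
by rewrite mulrS ffunE IH -addn1 PoszD mulrDr mulr1 addrC.
Qed.

Lemma half_succ : odd ell -> (ell.+1)./2.*2 = ell.+1.
Proof. by move=> odd_ell; rewrite -[RHS]odd_double_half /= odd_ell. Qed.

Lemma double_half r i : odd ell ->
  ((r *+ (ell.+1)./2) i *+ 2 = r i %[mod ell])%Z.
Proof.
move=> odd_ell; apply/eqP; rewrite eqz_mod_dvd lattice_mulrn -mulrnAr.
have -> : ((ell.+1)./2)%:Z *+ 2 = (ell.+1)%:Z.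
  by rewrite -[in RHS]half_succ // -muln2 PoszM -[_ *+ 2]mulr_natr.
have -> : r i * (ell.+1)%:Z - r i = r i * ell%:Z by rewrite -addn1 PoszD; ring.
exact: dvdz_mull.
Qed.

End LatticeArithmetic.

(** * Monomials of the Taft algebra *)
Section TaftMonomials.
Variables (k : fieldType) (n ell : nat) (q : k) (A : taft_algebra n ell q).
Hypothesis prim : ell.-primitive_root q.
Implicit Types (i j : 'I_n) (g : 'I_n -> nat) (a b : lattice n).

Local Notation K := (@taftK k n ell q A).
Local Notation x := (@taftx k n ell q A).
Local Notation Kp := (Kprod K).

Let q0 : q != 0 := prim_neq0 prim.

(** The exponent of theta on basis vectors: theta (eps_i, eps_j) = q ^ alt i j. *)
Definition alt i j : int := ((j < i)%N : nat)%:Z - ((i < j)%N : nat)%:Z.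

Lemma star_eps i j : star (eps i) (eps j) = ((j < i)%N : nat)%:Z.
Proof.
rewrite /star (bigD1 j) //= [X in _ + X]big1 => [|l lj]; last first.
  by apply: big1 => m _; rewrite !ffunE [j == l]eq_sym (negPf lj) mulr0.
rewrite addr0; case: (ltnP j i) => ji.
  rewrite (bigD1 i) //= big1 => [|m /andP[_ mi]]; first by rewrite !ffunE !eqxx addr0.
  by rewrite !ffunE [i == m]eq_sym (negPf mi) mul0r.
apply: big1 => m jm; rewrite !ffunE; case: eqP => [im|]; last by rewrite mul0r.
by move: jm; rewrite -im ltnNge ji.
Qed.

Lemma theta_eps i j : theta q (eps i) (eps j) = q ^ alt i j.
Proof. by rewrite /theta !star_eps. Qed.

Lemma taftK_unit i : K i \is a GRing.unit.
Proof.
have [_ uK _ _ _] := taft_relP A; have [e1 e2] := uK i.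
by apply/unitrP; exists (K i)^-1.
Qed.

Lemma taftK_comm i j : K i * K j = K j * K i.
Proof. by have [e _ _ _ _] := taft_relP A. Qed.

Lemma taftK_order i : K i ^+ ell = 1.
Proof. by have [_ _ e _ _] := taft_relP A. Qed.

Lemma taftx_nil i : x i ^+ ell = 0.
Proof. by have [_ _ _ _ [_ e]] := taft_relP A. Qed.

Lemma taftx_comm i j : x i * x j = q ^ alt i j *: (x j * x i).
Proof. by have [_ _ _ _ [e _]] := taft_relP A; rewrite e theta_eps. Qed.

Lemma taftKx i j : K i * x j = q ^ (alt i j + ((i == j) : nat)%:Z) *: (x j * K i).
Proof.
have [_ _ _ e _] := taft_relP A.
have := congr1 (fun y => y * K i) (e i j); rewrite mulrVK ?taftK_unit // => ->.
by rewrite theta_eps expfzDr // scalerAl.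
Qed.

Lemma Kprod0 : Kp 0 = 1.
Proof. by rewrite /Kprod big1 // => i _; rewrite ffunE expr0z. Qed.

Lemma KprodD a b : Kp (a + b) = Kp a * Kp b.
Proof.
rewrite /Kprod -prodrM_comm => [|i j _ _].
  by apply: eq_bigr => i _; rewrite ffunE exprzDr ?taftK_unit.
by apply: commrXz; apply/commr_sym/commrXz; exact: taftK_comm.
Qed.

Lemma KprodC a b : Kp a * Kp b = Kp b * Kp a.
Proof. by rewrite -!KprodD addrC. Qed.

Lemma Kprod_eps i : Kp (eps i) = K i.
Proof.
rewrite /Kprod.
have gen_ (r : seq 'I_n) : uniq r ->
    \prod_(j <- r) K j ^ (eps i j) = if i \in r then K i else 1.
  elim: r => [|j r IH] /=; first by rewrite big_nil.
  case/andP=> jr ur; rewrite big_cons IH // in_cons ffunE.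
  case: eqP => [->|_]; last by rewrite expr0z mul1r.
  by rewrite (negPf jr) mulr1.
by rewrite gen_ ?mem_index_enum // index_enum_uniq.
Qed.

Lemma KprodN a : Kp (- a) * Kp a = 1.
Proof. by rewrite -KprodD addNr Kprod0. Qed.

Lemma Kprod_unit a : Kp a \is a GRing.unit.
Proof. by apply/unitrP; exists (Kp (- a)); rewrite -!KprodD addNr addrN Kprod0. Qed.

Lemma KprodV a : (Kp a)^-1 = Kp (- a).
Proof. by rewrite -[LHS]mul1r -(KprodN a) mulrK ?Kprod_unit. Qed.

Lemma taftK_expz_mod i (m : int) : K i ^ (m %% ell%:Z)%Z = K i ^ m.
Proof.
rewrite [in RHS](divz_eq m ell%:Z) [X in _ = _ ^ (X + _)]mulrC exprzDr ?taftK_unit //.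
rewrite -exprz_exp.
by rewrite -exprnP taftK_order exp1rz mul1r.
Qed.

Lemma Kprod_residue a : Kp (residue ell a) = Kp a.
Proof. by apply: eq_bigr => i _; rewrite ffunE taftK_expz_mod. Qed.

Definition ofnat g : lattice n := [ffun i => (g i)%:Z].

Definition incr g i : 'I_n -> nat := fun j => (g j + (j == i))%N.

(** Exponents are arbitrary naturals and integers rather than elements of the box, so
that multiplying by a generator stays within the family; reduction to the box
is done by [mon_residue] and [mon_nil]. *)
Definition taft_mon g b : A := (\prod_(j < n) x j ^+ g j) * Kp b.

Local Notation mon := taft_mon.

Lemma eq_mon g g' b : g =1 g' -> mon g b = mon g' b.
Proof. by move=> e; congr (_ * _); apply: eq_bigr => j _; rewrite e. Qed.

Lemma mon_residue g b : mon g (residue ell b) = mon g b.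
Proof. by rewrite /taft_mon Kprod_residue. Qed.

Lemma mon_nil g b i : (ell <= g i)%N -> mon g b = 0.
Proof.
move=> lg; rewrite /taft_mon; have xg : x i ^+ g i = 0.
  by rewrite -(subnK lg) exprD taftx_nil mulr0.
have : (\prod_(j < n) x j ^+ g j) = 0.
  have : i \in index_enum 'I_n by exact: mem_index_enum.
  elim: (index_enum _) => // j r IH; rewrite in_cons big_cons.
  by case/predU1P=> [<-|/IH->]; rewrite ?xg ?mul0r ?mulr0.
by move->; rewrite mul0r.
Qed.

Lemma x_mon i g b : exists2 d, d != 0 & x i * mon g b = d *: mon (incr g i) b.
Proof.
have s0 i' j' : q ^ alt i' j' != 0 by exact: expfz_neq0.
have [d d0 e] := qcomm_absorb g s0 taftx_comm (index_enum_uniq _) (mem_index_enum i).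
by exists d => //; rewrite /taft_mon mulrA e scalerAl.
Qed.

Lemma mon_Kprod g b a : mon g b * Kp a = mon g (b + a).
Proof. by rewrite /taft_mon -mulrA -KprodD. Qed.

Lemma mon_KV g b i : mon g b * (K i)^-1 = mon g (b - eps i).
Proof. by rewrite -mon_Kprod -KprodV Kprod_eps. Qed.

Lemma qexp_prod (F : 'I_n -> int) : \prod_(j < n) q ^ F j = q ^ (\sum_(j < n) F j).
Proof.
by elim/big_rec2: _ => [|i y z _ ->]; rewrite ?expr0z // expfzDr.
Qed.

(** Why tilde appears: it collects the commutation exponents of a monomial with
one generator. *)
Lemma sum_alt_l b i : \sum_(j < n) b j * alt j i = b i - tilde b i.
Proof.
rewrite ffunE opprB addrCA.
have -> : b i - \sum_(j < n | (j <= i)%N) b j = - \sum_(j < n | (j < i)%N) b j.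
  rewrite (bigD1 i) //= opprD addrA subrr add0r; congr (- _).
  by apply: eq_bigl => j; rewrite andbC -(inj_eq val_inj) ltn_neqAle.
rewrite [X in X - _]big_mkcond [X in _ - X]big_mkcond -sumrN -big_split /=.
apply: eq_bigr => j _; rewrite /alt.
by case: (ltngtP i j) => _; rewrite ?subr0 ?sub0r ?mulr1 ?mulrN1 ?addr0 ?add0r ?mulr0 ?subrr.
Qed.

Lemma alt_sym i j : alt j i = - alt i j.
Proof. by rewrite /alt opprB. Qed.

Lemma sum_alt_r b i : \sum_(j < n) b j * alt i j = tilde b i - b i.
Proof.
rewrite -opprB -sum_alt_l -sumrN; apply: eq_bigr => j _.
by rewrite alt_sym mulrN.
Qed.

Lemma sum_delta b i : \sum_(j < n) b j * ((j == i) : nat)%:Z = b i.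
Proof.
rewrite (bigD1 i) //= eqxx mulr1 big1 ?addr0 // => j /negPf->.
by rewrite mulr0.
Qed.

Lemma Kprod_x b i : Kp b * x i = q ^ (b i *+ 2 - tilde b i) *: (x i * Kp b).
Proof.
have e j : K j ^ b j * x i = q ^ (b j * (alt j i + ((j == i) : nat)%:Z)) *: (x i * K j ^ b j).
  rewrite mulrC -exprz_exp; apply: qcommXz; first exact: taftK_unit.
    exact: expfz_neq0.
  exact: taftKx.
rewrite /Kprod (qcomm_prod _ e) qexp_prod; congr (q ^ _ *: _).
rewrite -[LHS]/(\sum_j _ * _); under eq_bigr => j _ do rewrite mulrDr.
by rewrite big_split /= sum_alt_l sum_delta addrC addrA mulr2n.
Qed.

Lemma xmon_x g i : (\prod_(j < n) x j ^+ g j) * x i =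
  q ^ (ofnat g i - tilde (ofnat g) i) *: (x i * \prod_(j < n) x j ^+ g j).
Proof.
have e j : x j ^+ g j * x i = q ^ (ofnat g j * alt j i) *: (x i * x j ^+ g j).
  by rewrite ffunE mulrC -exprz_exp -exprnP; apply: qcommX; exact: taftx_comm.
by rewrite (qcomm_prod _ e) qexp_prod sum_alt_l.
Qed.

Lemma mon_x g b i : mon g b * x i =
  q ^ (ofnat g i - tilde (ofnat g) i + b i *+ 2 - tilde b i) *: (x i * mon g b).
Proof.
rewrite {1}/taft_mon -mulrA Kprod_x -scalerAr mulrA xmon_x -scalerAl scalerA -mulrA.
by rewrite mulrC -expfzDr // addrA.
Qed.

Lemma K_xmon g i : K i * (\prod_(j < n) x j ^+ g j) =
  q ^ (tilde (ofnat g) i) *: ((\prod_(j < n) x j ^+ g j) * K i).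
Proof.
have e j : x j ^+ g j * K i =
    q ^ (ofnat g j * - (alt i j + ((i == j) : nat)%:Z)) *: (K i * x j ^+ g j).
  rewrite ffunE mulrC -exprz_exp -exprnP; apply: qcommX.
  by rewrite -invr_expz; apply: qcomm_sym; [exact: expfz_neq0|exact: taftKx].
have := qcomm_prod (index_enum 'I_n) e; rewrite qexp_prod.
set s := \sum_j _; have -> : s = - tilde (ofnat g) i.
  rewrite /s; under eq_bigr => j _ do rewrite mulrN mulrDr [i == j]eq_sym.
  by rewrite sumrN big_split /= sum_alt_r sum_delta subrK.
by rewrite -invr_expz => ->; rewrite scalerA divff ?scale1r ?expfz_neq0.
Qed.

Lemma K_mon g b i : K i * mon g b = q ^ (tilde (ofnat g) i) *: mon g (b + eps i).
Proof.
rewrite /taft_mon mulrA K_xmon -scalerAl -mulrA; congr (_ *: (_ * _)).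
by rewrite addrC KprodD Kprod_eps.
Qed.

End TaftMonomials.

(** * Basis, characters and group-likes of the Taft algebra *)
Section GroupLike.
Variables (k : fieldType) (H : hopfAlgType k).
Implicit Types g h : H.

Lemma tens_bilin (U V : vectType k) : bilin (fun (u : U) (v : V) => u (x) v).
Proof. by split=> u c a b; [rewrite tensPl|rewrite tensPr]. Qed.

Lemma group_likeM g h : comul g = g (x) g -> comul h = h (x) h ->
  comul (g * h) = (g * h) (x) (g * h).
Proof.
move=> gg hh; rewrite -[LHS]sweedler_id (sweedler_comulGl _ _ gg); last exact: tens_bilin.
rewrite hh sweedler_tens // => u; have [Bl Br] := bilin_mull (tens_bilin H H) g g.
  exact: Bl.
exact: Br.
Qed.

Lemma counit_group_like g : g != 0 -> comul g = g (x) g -> counit g = 1.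
Proof.
move=> g0 gg; have := rslice_counit g; rewrite (rslice_gl gg).
move/eqP; rewrite -subr_eq0 -[X in _ - X]scale1r -scalerBl scaler_eq0 (negPf g0) orbF.
by rewrite subr_eq0 => /eqP.
Qed.

Lemma antipode_group_like g : g != 0 -> comul g = g (x) g -> antipode g * g = 1.
Proof.
move=> g0 gg; have := antipodel g; rewrite (counit_group_like g0 gg) scale1r gg.
by rewrite sweedler_tens // => u; lin.
Qed.

End GroupLike.

Section TaftBasis.
Variables (k : fieldType) (n ell : nat) (q : k) (A : taft_algebra n ell q).
Hypothesis prim : ell.-primitive_root q.
Implicit Types (i j : 'I_n) (g : 'I_n -> nat) (a b al be : lattice n).

Local Notation K := (@taftK k n ell q A).
Local Notation x := (@taftx k n ell q A).
Local Notation Kp := (Kprod K).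

Let q0 : q != 0 := prim_neq0 prim.
Let ell0 : (0 < ell)%N := prim_order_gt0 prim.

Definition bounded g := forall i, (g i < ell)%N.

Definition box_nat g : box n ell := [ffun i => Ordinal (ltn_pmod (g i) ell0)].

Lemma residue_lt a i : (`|(a i %% ell%:Z)%Z|%N < ell)%N.
Proof.
have e0 : ell%:Z != 0 by rewrite -lt0n.
by rewrite -ltz_nat gez0_abs ?modz_ge0 // ltz_pmod.
Qed.

Definition box_int a : box n ell := [ffun i => Ordinal (residue_lt a i)].

Lemma box_natE g i : bounded g -> (box_nat g i : nat) = g i.
Proof. by move=> bg; rewrite ffunE /= modn_small. Qed.

Lemma box_intE a : box_val (box_int a) = residue ell a.
Proof.
apply/ffunP => i; rewrite !ffunE /= gez0_abs // modz_ge0 //.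
by rewrite -lt0n.
Qed.

Definition bmon (gb : box n ell * box n ell) : A := taft_mon A (fun i => gb.1 i) (box_val gb.2).

Lemma taft_monomialE (i : 'I_#|{: box n ell * box n ell}|) :
  (taft_monomials ell K x)`_i = bmon (enum_val i).
Proof.
rewrite -tnth_nth tnth_mktuple; case: (enum_val i) => g b.
rewrite /bmon /taft_mon /xprod; congr (_ * _); apply: eq_bigr => j _.
by rewrite ffunE.
Qed.

Lemma taft_expand (h : A) :
  h = \sum_gb taft_coord gb.1 gb.2 h *: bmon gb.
Proof.
rewrite [LHS](coord_basis (taft_basis A) (memvf h)).
rewrite [RHS](reindex_onto (@enum_val _ predT) enum_rank) /=; last first.
  by move=> gb _; rewrite enum_rankK.
apply: eq_big => [m|m _]; first by rewrite enum_valK eqxx.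
by rewrite taft_monomialE /taft_coord -surjective_pairing enum_valK.
Qed.

Lemma taft_coord_mon gb gb' : taft_coord gb.1 gb.2 (bmon gb') = (gb == gb')%:R.
Proof.
rewrite /taft_coord -surjective_pairing -[gb' in LHS]enum_rankK -taft_monomialE.
rewrite coord_free ?(basis_free (taft_basis A)) //.
by rewrite (inj_eq enum_rank_inj) eq_sym.
Qed.

Lemma mon_box g b : bounded g -> taft_mon A g b = bmon (box_nat g, box_int b).
Proof.
move=> bg; rewrite /bmon /= box_intE mon_residue; apply: eq_mon => i.
by rewrite box_natE.
Qed.

(** Linear statements may be checked on the monomial basis. *)
Lemma mon_ind (P : A -> Prop) : (forall c u v, P u -> P v -> P (c *: u + v)) ->
  (forall g b, bounded g -> P (taft_mon A g b)) -> forall h, P h.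
Proof.
move=> PL Pm h.
have P0 : P 0.
  have Pm0 := Pm (fun=> 0%N) 0 (fun _ => ell0).
  by have := PL (- 1) _ _ Pm0 Pm0; rewrite scaleN1r addNr.
rewrite (taft_expand h); elim/big_rec: _ => // gb y _ Py; apply: PL => //.
by apply: Pm => i; exact: ltn_ord.
Qed.

Lemma taft_ind (P : A -> Prop) :
  (forall c u v, P u -> P v -> P (c *: u + v)) -> P 1 ->
  (forall i h, P h -> P (K i * h)) -> (forall i h, P h -> P (x i * h)) ->
  forall h, P h.
Proof.
move=> PL P1 PK Px.
have Pprod (F : 'I_n -> A) (m : 'I_n -> nat) (r : seq 'I_n) y :
    (forall i h, P h -> P (F i * h)) -> P y -> P ((\prod_(j <- r) F j ^+ m j) * y).
  move=> PF Py; elim: r => [|j r IH]; first by rewrite big_nil mul1r.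
  rewrite big_cons -mulrA; elim: (m j) => [|e IHe]; first by rewrite mul1r.
  by rewrite exprS -mulrA; apply: PF.
apply: mon_ind => // g b bg; rewrite (mon_box _ bg); apply: (Pprod) => //.
rewrite -[Kp _]mulr1 /Kprod.
have -> : \prod_(i < n) K i ^ box_val (box_nat g, box_int b).2 i =
   \prod_(i < n) K i ^+ (box_int b i).
  by apply: eq_bigr => i _; rewrite [in LHS]ffunE.
exact: Pprod.
Qed.

Lemma taft_skew_generated : skew_generated K x.
Proof.
split.
- exact: taftK_unit.
- exact: taft_comulK.
- exact: taft_comulx.
- exact: taft_counitK.
- exact: taft_counitx.
- exact: taft_antipodeK.
- exact: taft_antipodex.
exact: taft_ind.
Qed.

Lemma qpairing_residue al b : q ^ pairing al (residue ell b) = q ^ pairing al b.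
Proof.
rewrite /pairing -!(qexp_prod prim); apply: eq_bigr => i _; apply/eqP.
by rewrite (prim_exprz_eq prim) ffunE modzMmr.
Qed.

Lemma taft_charE al g b : bounded g ->
  taft_char A al (taft_mon A g b) = (if [forall i, g i == 0%N] then q ^ pairing al b else 0).
Proof.
move=> bg; rewrite linfunE.
  rewrite (mon_box _ bg) pair_big /= (bigD1 (box_nat g, box_int b)) //=.
  rewrite (taft_coord_mon (box_nat g, box_int b)) eqxx mul1r.
  rewrite big1 ?addr0 => [|gb ne]; last first.
    by rewrite taft_coord_mon (negPf ne) mul0r.
  rewrite box_intE qpairing_residue; congr (if _ then _ else _).
  apply/eqP/forallP => [/ffunP e i|e].
    by have := e i; rewrite !ffunE /= modn_small // => -[->].
  by apply/ffunP => i; rewrite !ffunE /= (eqP (e i)) mod0n.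
move=> c u v; rewrite scaler_sumr -big_split; apply: eq_bigr => ga _ /=.
rewrite scaler_sumr -big_split; apply: eq_bigr => bb _ /=.
by rewrite /taft_coord linearP mulrDl -mulrA.
Qed.

Lemma pairing_eps al b i : pairing al (b + eps i) = pairing al b + al i.
Proof.
rewrite -[al i](sum_delta al) -big_split; apply: eq_bigr => j _ /=.
by rewrite !ffunE mulrDr [i == j]eq_sym.
Qed.

Lemma taft_is_character al : is_character K x (taft_char A al) (fun i => q ^ al i).
Proof.
have b0 : bounded (fun=> 0%N) by move=> i; exact: ell0.
split.
- have -> : (1 : A) = taft_mon A (fun=> 0%N) 0.
    by rewrite /taft_mon Kprod0 mulr1 big1.
  rewrite taft_charE //; have -> : [forall i : 'I_n, 0%N == 0%N] by apply/forallP.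
  by rewrite /pairing big1 ?expr0z // => i _; rewrite ffunE mulr0.
- move=> i; apply: mon_ind => [c u v hu hv|g b bg].
    rewrite mulrDr -scalerAr !hdualP hu hv mulrDr.
    by rewrite !mulrA [c * _]mulrC.
  rewrite (K_mon A prim) linearZ /= !taft_charE //.
  case: ifP => [/forallP g0|_]; last by rewrite mulr0 scaler0.
  have -> : ofnat g = 0 by apply/ffunP => j; rewrite !ffunE (eqP (g0 j)).
  by rewrite tilde0 expr0z scale1r pairing_eps expfzDr // mulrC.
move=> i; apply: mon_ind => [c u v hu hv|g b bg].
  by rewrite mulrDr -scalerAr linearP /= hu hv scaler0 addr0.
have [d d0 ->] := x_mon A prim i g b; rewrite linearZ /=.
case: (boolP [forall j, incr g i j < ell]%N) => [/forallP bi|].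
  rewrite taft_charE //; case: ifP => [/forallP/(_ i)|_]; last by rewrite scaler0.
  by rewrite /incr eqxx addn1.
rewrite negb_forall => /existsP[j]; rewrite -leqNgt => lj.
by rewrite (mon_nil A _ lj) linear0 scaler0.
Qed.

Lemma taftK_group_like b : comul (Kp b) = Kp b (x) Kp b.
Proof.
rewrite -Kprod_residue.
have -> : Kp (residue ell b) = \prod_(i < n) K i ^+ (box_int b i).
  by apply: eq_bigr => i _; rewrite -box_intE ffunE.
apply: (big_ind (fun y : A => comul y = y (x) y)) => [|u v|i _].
- exact: comul1.
- exact: group_likeM.
elim: (nat_of_ord _) => [|m IH]; first exact: comul1.
by rewrite exprS; apply: group_likeM => //; exact: taft_comulK.
Qed.

Lemma Kprod_neq0 b : Kp b != 0.
Proof. by apply: contraTneq (Kprod_unit A b) => ->; rewrite unitr0. Qed.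

Lemma antipode_Kprod b : antipode (Kp b) = Kp (- b).
Proof.
have := antipode_group_like (Kprod_neq0 b) (taftK_group_like b).
by move/(canRL (mulrK (Kprod_unit A b))); rewrite mul1r KprodV.
Qed.

Lemma antipodeV_Kprod b : antipodeV A (Kp b) = Kp (- b).
Proof.
by have := antipodeK taft_skew_generated (Kp (- b)); rewrite antipode_Kprod opprK.
Qed.

End TaftBasis.

(** * The modules A(al, be) *)
Lemma free_dual (k : fieldType) (U : vectType k) (T : eqType) (F : T -> U)
    (f : T -> 'Hom(U, k^o)) (L : seq T) :
  (forall t t', f t (F t') = ((t == t')%:R : k)) -> uniq L -> free (map F L).
Proof.
move=> fF; elim: L => [|t L IH] /=; first by rewrite nil_free.
case/andP=> tL uL; rewrite free_cons IH // andbT.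
apply/negP => Ft; have : (<<map F L>> <= lker (f t))%VS.
  apply/span_subvP => u /mapP[t' t'L ->]; rewrite memv_ker fF.
  by have [tt'|] := eqVneq t t'; [rewrite tt' t'L in tL|].
move/subvP/(_ _ Ft); rewrite memv_ker fF eqxx.
by rewrite (oner_eq0 k).
Qed.

Section TaftModules.
Variables (k : fieldType) (n ell : nat) (q : k) (A : taft_algebra n ell q).
Hypothesis prim : ell.-primitive_root q.
Implicit Types (i j : 'I_n) (g : 'I_n -> nat) (a b al be : lattice n)
  (gb : (box n ell * box n ell)%type).

Local Notation K := (@taftK k n ell q A).
Local Notation x := (@taftx k n ell q A).
Local Notation Kp := (Kprod K).
Local Notation mon := (taft_mon A).

Let q0 : q != 0 := prim_neq0 prim.
Let ell0 : (0 < ell)%N := prim_order_gt0 prim.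
Let gen : skew_generated K x := taft_skew_generated A prim.

Definition mdeg g : nat := (\sum_i g i)%N.
Definition decr g i : 'I_n -> nat := fun j => (g j - (j == i))%N.

Lemma decrK g i : (0 < g i)%N -> incr (decr g i) i =1 g.
Proof.
by move=> gi j; rewrite /incr /decr; case: eqP => [->|_]; rewrite ?subnK ?subn0 ?addn0.
Qed.

Lemma mdeg_incr g i : mdeg (incr g i) = (mdeg g).+1.
Proof.
rewrite /mdeg /incr big_split /= [X in (_ + X)%N](bigD1 i) //= eqxx.
rewrite [X in (_ + (_ + X))%N]big1 => [|j ne]; first by rewrite addn0 addn1.
by rewrite (negPf ne).
Qed.

Lemma eq_mdeg g g' : g =1 g' -> mdeg g = mdeg g'.
Proof. by move=> e; apply: eq_bigr. Qed.

Lemma mdeg_decr g i : (0 < g i)%N -> mdeg g = (mdeg (decr g i)).+1.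
Proof. by move=> gi; rewrite -(mdeg_incr _ i); apply: eq_mdeg => j; rewrite decrK. Qed.

Lemma mdeg0P g : (g =1 fun=> 0%N) \/ exists i, (0 < g i)%N.
Proof.
case: (boolP [exists i, 0 < g i]%N) => [/existsP|]; first by right.
rewrite negb_exists => /forallP e; left=> i.
by apply/eqP; have := e i; rewrite -eqn0Ngt.
Qed.

Lemma ofnat_incr g i : ofnat (incr g i) = ofnat g + eps i.
Proof. by apply/ffunP => j; rewrite !ffunE /incr PoszD [i == j]eq_sym. Qed.

Lemma mon0 g b : g =1 (fun=> 0%N) -> mon g b = Kp b.
Proof. by move=> e; rewrite /(mon _ _) big1 ?mul1r // => j _; rewrite e. Qed.

Lemma mon_decr g b i : (0 < g i)%N ->
  exists2 d, d != 0 & mon g b = d *: (x i * mon (decr g i) b).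
Proof.
move=> gi; have [d d0 e] := x_mon A prim i (decr g i) b.
exists d^-1; first by rewrite invr_eq0.
by rewrite e scalerA mulVf // scale1r; apply: eq_mon => j; rewrite decrK.
Qed.

(** The coproduct of x^g K(b) has the extreme terms K(g + b) (x) x^g K(b) and
x^g K(b) (x) K(b); in every other term both factors have smaller x-degree than
g.  So a functional vanishing below degree g sees only one extreme term on each
side.  Proved by splitting off one x_i at a time. *)
Lemma slice_top (p : hdual A) g b : (forall g' b', (mdeg g' < mdeg g)%N -> p (mon g' b') = 0) ->
  rslice p (mon g b) = (p (mon g b) : k) *: Kp (ofnat g + b) /\
  lslice p (mon g b) = (p (mon g b) : k) *: Kp b.
Proof.
move: {-2}(mdeg g) (erefl (mdeg g)) => m; elim: m p g => [|m IH] p g gm pv.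
  have [g0|[i gi]] := mdeg0P g; last by rewrite (mdeg_decr gi) in gm.
  rewrite mon0 // (rslice_gl (taftK_group_like A prim b)).
  rewrite (lslice_gl (taftK_group_like A prim b)); split=> //.
  by congr (_ *: Kp _); apply/ffunP => j; rewrite !ffunE g0 add0r.
have [g0|[i gi]] := mdeg0P g; first by move: gm; rewrite /mdeg big1 // => j _; rewrite g0.
have [d d0 ->] := mon_decr b gi; set h := mon (decr g i) b.
have dm : mdeg (decr g i) = m by apply/eqP; rewrite -eqSS -(mdeg_decr gi) gm.
have ph : p h = 0 by apply: pv; rewrite dm.
have [r1 l1] := IH p _ (esym dm) (fun g' b' lt => pv g' b' (ltnW lt)).
have pv' (g' : 'I_n -> nat) (b' : lattice n) : (mdeg g' < m)%N -> pull_l p (x i) (mon g' b') = 0.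
  move=> lt; rewrite pull_lE; have [e _ ->] := x_mon A prim i g' b'.
  by rewrite linearZ /= pv ?scaler0 // mdeg_incr.
have [r2 l2] := IH _ _ (esym dm) pv'.
have pvK (g' : 'I_n -> nat) (b' : lattice n) : (mdeg g' < m)%N -> pull_l p (K i) (mon g' b') = 0.
  by move=> lt; rewrite pull_lE (K_mon A prim) linearZ /= pv ?scaler0 // ltnW.
have [_ l3] := IH _ _ (esym dm) pvK.
have pK : pull_l p (K i) h = 0.
  by rewrite pull_lE (K_mon A prim) linearZ /= pv ?scaler0 // dm.
rewrite !linearZ /= (rsliceSl _ _ (sg_comulx gen i)) (lsliceSl _ _ (sg_comulx gen i)).
rewrite r1 r2 l2 l3 -/h ph pK !scale0r !mulr0 add0r addr0 pull_lE.
rewrite -scalerAr !scalerA; split=> //; congr (_ *: _).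
rewrite -Kprod_eps -KprodD; congr (Kp _); rewrite addrA; congr (_ + _).
by rewrite addrC -ofnat_incr; apply/ffunP => j; rewrite !ffunE decrK.
Qed.

Definition coord_fun (gb : box n ell * box n ell) : hdual A :=
  linfun (taft_coord gb.1 gb.2 : A -> k^o).

Lemma coord_funE gb h : coord_fun gb h = taft_coord gb.1 gb.2 h.
Proof. by rewrite linfunE // => c u v; rewrite /taft_coord linearP. Qed.

Lemma coord_fun_bmon gb gb' : coord_fun gb (bmon A gb') = ((gb == gb')%:R : k).
Proof. by rewrite coord_funE taft_coord_mon. Qed.

Lemma coord_fun_low gb g b : (mdeg g < mdeg (fun i => gb.1 i))%N -> coord_fun gb (mon g b) = 0.
Proof.
move=> lt; case: (boolP [forall i, g i < ell]%N) => [/forallP bg|]; last first.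
  rewrite negb_forall => /existsP[i]; rewrite -leqNgt => lg.
  by rewrite (mon_nil A _ lg) linear0.
rewrite (mon_box A prim _ bg) coord_fun_bmon; case: eqP => // e.
move: lt; rewrite e /= (@eq_mdeg _ g) ?ltnn // => i.
by rewrite box_natE.
Qed.

(** Slice an element of W by the coordinate of one of its monomials of maximal
degree: by [slice_top] only that monomial contributes, and it contributes a
multiple of some K(be). *)
Lemma coideal_group_like (W : {vspace A}) : W != 0%VS ->
  (forall p w, w \in W -> rslice p w \in W) ->
  exists2 be, in_box ell be & Kp be \in W.
Proof.
move=> W0 WR; pose w := vpick W.
have w0 : w != 0 by rewrite vpick0.
have Ww : w \in W by exact: memv_pick.
have [gb1 c1] : exists gb, taft_coord gb.1 gb.2 w != 0.
  apply/existsP; apply: contraNT w0; rewrite negb_exists => /forallP e.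
  rewrite (taft_expand w) big1 // => gb _.
  by have /negPn/eqP-> := e gb; rewrite scale0r.
pose P gb := taft_coord gb.1 gb.2 w != 0.
have [gb c0 gbmax] := @arg_maxnP _ gb1 P (fun gb => mdeg (fun i => gb.1 i)) c1.
have := WR (coord_fun gb) _ Ww.
have -> : rslice (coord_fun gb) w =
    taft_coord gb.1 gb.2 w *: Kp (ofnat (fun i => gb.1 i) + box_val gb.2).
  rewrite [in LHS](taft_expand w) linear_sum (bigD1 gb) //= linearZ /=.
  have [-> _] : _ /\ _ := slice_top (box_val gb.2) (fun g' b' => @coord_fun_low gb g' b').
  rewrite -/(bmon A gb) coord_fun_bmon eqxx scale1r big1 ?addr0 // => gb' ne.
  rewrite linearZ /=; have [lt|ge] := ltnP (mdeg (fun i => gb.1 i)) (mdeg (fun i => gb'.1 i)).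
    case: (eqVneq (taft_coord gb'.1 gb'.2 w) 0) => [->|c0']; first by rewrite scale0r.
    by have := gbmax _ c0'; rewrite /= leqNgt lt.
  have [|-> _] := @slice_top (coord_fun gb) (fun i => gb'.1 i) (box_val gb'.2).
    by move=> g' b' lt; apply: coord_fun_low; exact: leq_trans lt ge.
  by rewrite -/(bmon A gb') coord_fun_bmon eq_sym (negPf ne) scale0r scaler0.
set be := _ + _ => We; exists (residue ell be); first exact: residue_in_box ell0.
rewrite Kprod_residue -[Kp be]scale1r -(mulVf c0) -scalerA; exact: memvZ.
Qed.

Section Module.
Variables al be : lattice n.
Local Notation chi := (taft_char A al).
Local Notation act := (twist_act chi).
Local Notation V := (taft_simple A al be).

Let chiP : is_character K x chi (fun i => q ^ al i) := taft_is_character A prim al.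

(** The exponent be - g of K is forced by the action: x_i raises the x-degree and
divides by K_i. *)
Definition wvec g : A := mon g (be - ofnat g).

(** The coefficient of the q-commutator of x_i with v_g, up to a nonzero scalar. *)
Definition xcoef g i : k := q ^ al i - q ^ (- tilde be i + be i *+ 2 - (g i)%:Z).

Lemma eq_wvec g g' : g =1 g' -> wvec g = wvec g'.
Proof.
move=> e; rewrite /wvec; have -> : ofnat g = ofnat g' by apply/ffunP => i; rewrite !ffunE e.
exact: eq_mon.
Qed.

Lemma act_x_wvec i g :
  exists2 d, d != 0 & act (x i) (wvec g) = (xcoef g i * d) *: wvec (incr g i).
Proof.
have [d d0 e] := x_mon A prim i g (be - ofnat g); exists d => //.
rewrite (twist_actx1 gen chiP) /wvec (mon_x A prim) -scalerBl -scalerAl.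
rewrite e -scalerAl mon_KV scalerA ofnat_incr opprD.
congr (_ * _ *: taft_mon _ _ _); last by rewrite addrA.
rewrite /xcoef tildeB; congr (_ - q ^ _).
have -> : (be - ofnat g) i = be i - (g i)%:Z by rewrite !ffunE.
have -> : ofnat g i = (g i)%:Z by rewrite ffunE.
by ring.
Qed.

Lemma act_K_wvec i g : act (K i) (wvec g) = q ^ (al i + tilde (ofnat g) i) *: wvec g.
Proof.
rewrite (twist_actK1 gen chiP) /wvec (K_mon A prim) -scalerAl mon_KV addrK scalerA.
by rewrite expfzDr.
Qed.

Definition kapn i : nat := `|kappa ell al be i|%N.

Lemma kapnE i : (kapn i)%:Z = kappa ell al be i.
Proof.
have /andP[h _] := @residue_in_box n ell (- tilde be + be *+ 2 - al) ell0 i.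
by rewrite /kapn gez0_abs.
Qed.

Lemma kapn_lt i : (kapn i < ell)%N.
Proof.
have /andP[_ h] := @residue_in_box n ell (- tilde be + be *+ 2 - al) ell0 i.
by rewrite -ltz_nat kapnE /kappa; move: h; lia.
Qed.

Lemma xcoef_eq0 i g : bounded ell g -> (xcoef g i == 0) = (g i == kapn i).
Proof.
move=> bg; rewrite /xcoef subr_eq0 (prim_exprz_eq prim).
have kE : kappa ell al be i = ((- tilde be i + be i *+ 2 - al i) %% ell%:Z)%Z.
  by rewrite !ffunE -mulr2n.
rewrite eqz_mod_dvd -[in RHS]eqz_nat kapnE kE.
have -> : al i - (- tilde be i + be i *+ 2 - (g i)%:Z) =
   (g i)%:Z - (- tilde be i + be i *+ 2 - al i) by ring.
rewrite -eqz_mod_dvd [X in X == _]modz_small //.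
by rewrite ltz_nat bg.
Qed.

(** Reached from K(be) by applying the x_i, whose coefficients do not vanish as long
as the exponents stay below kappa. *)
Lemma wvec_cyclic g : (forall i, g i <= kapn i)%N -> wvec g \in V.
Proof.
move: {-2}(mdeg g) (erefl (mdeg g)) => m; elim: m g => [|m IH] g gm gk.
  have [g0|[i gi]] := mdeg0P g; last by rewrite (mdeg_decr gi) in gm.
  rewrite /wvec mon0 //; have -> : be - ofnat g = be.
    by apply/ffunP => j; rewrite !ffunE g0 subr0.
  exact: (cyclic_gen gen _ chiP).
have [g0|[i gi]] := mdeg0P g; first by move: gm; rewrite /mdeg big1 // => j _; rewrite g0.
have gk' j : (decr g i j <= kapn j)%N by exact: leq_trans (leq_subr _ _) (gk j).
have lt : (decr g i i < kapn i)%N.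
  by apply: leq_trans (gk i); rewrite /decr eqxx subn1 ltn_predL.
have V1 : wvec (decr g i) \in V.
  by apply: IH gk'; apply/eqP; rewrite -eqSS -(mdeg_decr gi) gm.
have := cyclic_act_stable gen chiP (x i) V1.
have [d d0 ->] := act_x_wvec i (decr g i).
rewrite (eq_wvec (decrK gi)) => Vg.
have c0 : xcoef (decr g i) i * d != 0.
  rewrite mulf_neq0 // xcoef_eq0 ?(ltn_eqF lt) // => j.
  exact: leq_ltn_trans (gk' j) (kapn_lt j).
by rewrite -[wvec g]scale1r -(mulVf c0) -scalerA; exact: memvZ.
Qed.

Definition kap_box : {set box n ell} :=
  [set g : box n ell | [forall i, (g i <= kapn i)%N]].
Definition wbox (g : box n ell) : A := wvec (fun i => g i).
Definition wbasis : seq A := map wbox (enum kap_box).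

Lemma wbasis_mem g : (forall i, g i <= kapn i)%N -> wvec g \in <<wbasis>>%VS.
Proof.
move=> gk; have bg : bounded ell g by move=> i; exact: leq_ltn_trans (gk i) (kapn_lt i).
have -> : wvec g = wbox (box_nat prim g) by apply: eq_wvec => i; rewrite box_natE.
apply/memv_span/map_f; rewrite mem_enum inE; apply/forallP => i.
by rewrite box_natE.
Qed.

(** The span of the v_g with g <= kappa is stable because x_i kills v_g when
g_i = kappa_i. *)
Lemma cyclic_wbasis : V = <<wbasis>>%VS.
Proof.
apply/eqP; rewrite eqEsubv; apply/andP; split; last first.
  apply/span_subvP => u /mapP[g]; rewrite mem_enum inE => /forallP gk ->.
  exact: wvec_cyclic.
apply/subvP => u /(cyclicP _ _)[h ->].
have act_lin h' := linear_fun (@twist_act_is_linear_r k A chi h').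
have stab h' : (forall g, (forall i, g i <= kapn i)%N -> act h' (wvec g) \in <<wbasis>>%VS) ->
    forall u, u \in <<wbasis>>%VS -> act h' u \in <<wbasis>>%VS.
  move=> st u' /(coord_span (X := in_tuple wbasis)) ->.
  have [_ _ aZ _] := act_lin h'.
  have -> : act h' (\sum_(i < size wbasis) coord (in_tuple wbasis) i u' *: (in_tuple wbasis)`_i)
     = \sum_(i < size wbasis) coord (in_tuple wbasis) i u' *: act h' wbasis`_i.
    have aS := linfunE (@twist_act_is_linear_r k A chi h').
    by rewrite -aS linear_sum; apply: eq_bigr => i _; rewrite linearZ /= aS.
  apply: memv_suml => i _; apply: memvZ.
  have /mapP[g] : wbasis`_i \in wbasis by exact: mem_nth.
  by rewrite mem_enum inE => /forallP gk ->; exact: st.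
have stK i := stab (K i); have stx i := stab (x i).
move: h; apply: (taft_ind prim) => [c u' v' hu hv||i h hh|i h hh].
- by rewrite (@twist_act_is_linear_l k A chi) memvD ?memvZ.
- rewrite (twist_act1 gen chiP); have := @wbasis_mem (fun=> 0%N) (fun=> leq0n _).
  rewrite /wvec mon0 //; have -> // : be - ofnat (fun=> 0%N) = be.
  by apply/ffunP => j; rewrite !ffunE subr0.
- rewrite (twist_actM gen chiP); apply: stK => // g gk.
  by rewrite act_K_wvec memvZ ?wbasis_mem.
rewrite (twist_actM gen chiP); apply: stx => // g gk.
have bg : bounded ell g by move=> j; exact: leq_ltn_trans (gk j) (kapn_lt j).
have [d d0 ->] := act_x_wvec i g.
have [e|ne] := eqVneq (g i) (kapn i).
  have /eqP -> : xcoef g i == 0 by rewrite xcoef_eq0 // e.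
  by rewrite mul0r scale0r mem0v.
apply/memvZ/wbasis_mem => j; rewrite /incr; case: eqP => [->|_]; last by rewrite addn0.
by rewrite addn1 ltn_neqAle ne gk.
Qed.

Lemma free_wbasis : free wbasis.
Proof.
pose idx (g : box n ell) := (g, box_int prim (be - ofnat (fun i => g i))).
apply: (free_dual (f := fun g : box n ell => coord_fun (idx g))); last exact: enum_uniq.
move=> g1 g2; have -> : wbox g2 = bmon A (idx g2).
  rewrite /wbox /wvec (mon_box A prim) => [|i]; last exact: ltn_ord.
  congr (bmon A (_, _)); apply/ffunP => i; apply: val_inj.
  by rewrite ffunE /= modn_small.
rewrite coord_fun_bmon; congr (_%:R); congr (nat_of_bool _).
by apply/eqP/eqP => [[]|->].
Qed.

Lemma dim_taft_simple : \dim V = (\prod_i (kapn i + 1))%N.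
Proof.
rewrite cyclic_wbasis (eqP free_wbasis) size_map -cardE.
have -> : #|kap_box| = #|family (fun i => [pred j : 'I_ell | (j <= kapn i)%N])|.
  by apply: eq_card => g; rewrite inE; apply/forallP/familyP => h i; have := h i.
rewrite card_family foldrE big_map big_enum /=; apply: eq_bigr => i _.
rewrite -sum1_card (eq_bigl (fun j : 'I_ell => (j < (kapn i).+1)%N)) //.
by rewrite (big_ord_narrow (kapn_lt i)) /= sum_nat_const card_ord muln1 addn1.
Qed.

End Module.
End TaftModules.

(** * Isomorphisms and self-duality *)
Section Transport.
Variables (k : fieldType) (H : hopfAlgType k).

Definition act_linear (M : vectType k) (act : drinfeld_double H -> M -> M) : Prop :=
  forall d, linear (act d).

Lemma module_act_linear (M : vectType k) (act : drinfeld_double H -> M -> M) :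
  is_double_module act -> act_linear act.
Proof. by case=> _ e _ _ d c u v; exact: e. Qed.

Lemma double_iso_inv (M N : vectType k) (actM : drinfeld_double H -> M -> M)
    (actN : drinfeld_double H -> N -> N) :
  double_iso actM actN ->
  exists f : 'Hom(M, N), exists g : 'Hom(N, M),
    [/\ cancel f g, cancel g f, forall d m, f (actM d m) = actN d (f m)
      & forall d m, g (actN d m) = actM d (g m)].
Proof.
case=> f [h fh hf] fL; have kf : lker f == 0%VS by apply/lker0P/(can_inj fh).
have fK : cancel f (f^-1)%VF by exact: lker0_lfunK.
have gK : cancel (f^-1)%VF f by move=> n; rewrite -[n]hf fK.
exists f, (f^-1)%VF; split=> // d m.
by rewrite -{1}[m]gK -fL fK.
Qed.

Lemma double_iso_sym (M N : vectType k) (actM : drinfeld_double H -> M -> M)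
    (actN : drinfeld_double H -> N -> N) :
  double_iso actM actN -> double_iso actN actM.
Proof. by case/double_iso_inv=> f [g [fK gK _ gL]]; exists g => //; exists f. Qed.

Lemma double_iso_trans (M N P : vectType k) (actM : drinfeld_double H -> M -> M)
    (actN : drinfeld_double H -> N -> N) (actP : drinfeld_double H -> P -> P) :
  double_iso actM actN -> double_iso actN actP -> double_iso actM actP.
Proof.
case=> f bf fL [g bg gL]; exists (g \o f)%VF.
  by apply: (eq_bij (bij_comp bg bf)) => m; rewrite /= comp_lfunE.
by move=> d m; rewrite !comp_lfunE fL gL.
Qed.

Lemma self_dual_iso (M N : vectType k) (actM : drinfeld_double H -> M -> M)
    (actN : drinfeld_double H -> N -> N) :
  act_linear actM -> act_linear actN ->
  double_iso actM actN -> self_dual actM -> self_dual actN.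
Proof.
move=> lM lN /double_iso_inv[f [g [fK gK fL gL]]] [F [G FK GK] FL].
have dE (P : vectType k) (actP : drinfeld_double H -> P -> P) (lP : act_linear actP) d
    (phi : 'Hom(P, k^o)) m : dual_act actP d phi m = phi (actP (double_antipode d) m).
  by rewrite linfunE // => c u v; rewrite lP linearP.
have L : linear (fun n => (F (g n) \o g)%VF : 'Hom(N, k^o)).
  by move=> c u v; rewrite !linearP comp_lfunDl comp_lfunZl.
exists (linfun (fun n => (F (g n) \o g)%VF : 'Hom(N, k^o))).
  exists (fun phi => f (G (phi \o f)%VF)) => [n|phi]; rewrite (linfunE L).
    rewrite -[RHS]gK; congr (f _); rewrite -[RHS]FK; congr (G _).
    by apply/lfunP => m; rewrite !comp_lfunE fK.
  by apply/lfunP => n; rewrite comp_lfunE fK GK comp_lfunE gK.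
move=> d n; rewrite !(linfunE L); apply/lfunP => n'.
by rewrite dE // !comp_lfunE gL FL dE // gL.
Qed.

End Transport.

(** * Weight functionals on modules *)
Section WeightFunctional.
Variables (k : fieldType) (n ell : nat) (q : k) (A : taft_algebra n ell q).
Hypothesis prim : ell.-primitive_root q.
Implicit Types (i j : 'I_n) (g : 'I_n -> nat).

Local Notation K := (@taftK k n ell q A).
Local Notation x := (@taftx k n ell q A).
Local Notation mon := (taft_mon A).
Local Notation eps := (counit : hdual A).

Let q0 : q != 0 := prim_neq0 prim.
Let ell0 : (0 < ell)%N := prim_order_gt0 prim.
Let gen : skew_generated K x := taft_skew_generated A prim.

Variables (M : vectType k) (actM : drinfeld_double A -> M -> M).
Hypothesis modM : is_double_module actM.

(** The right action of H on functionals. *)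
Definition right_mult (phi : 'Hom(M, k^o)) (h : A) : 'Hom(M, k^o) :=
  linfun (fun m => phi (actM (eps (x) h) m)).

Lemma right_multE phi h m : right_mult phi h m = phi (actM (eps (x) h) m).
Proof. by rewrite linfunE // => c u v; rewrite (actMr modM) linearP. Qed.

Lemma right_mult_is_linear phi : linear (right_mult phi).
Proof.
move=> c u v; apply/lfunP => m; rewrite add_lfunE scale_lfunE !right_multE.
by rewrite tensPr (actMl modM) linearP.
Qed.

Lemma right_multZ phi c h : right_mult phi (c *: h) = c *: right_mult phi h.
Proof. by have [_ _ e _] := linear_fun (right_mult_is_linear phi); exact: e. Qed.

Lemma right_mult0 phi : right_mult phi 0 = 0.
Proof. by have [e _ _ _] := linear_fun (right_mult_is_linear phi); exact: e. Qed.

Lemma right_multB phi u v : right_mult phi (u - v) = right_mult phi u - right_mult phi v.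
Proof.
have [_ eD _ eN] := linear_fun (right_mult_is_linear phi).
by rewrite (eD u (- v)) (eN v).
Qed.

Lemma right_multM phi u v : right_mult (right_mult phi u) v = right_mult phi (u * v).
Proof.
apply/lfunP => m; rewrite !right_multE -(double_mul_1h gen).
by rewrite (actM_mul modM).
Qed.

Lemma right_mult1 phi : right_mult phi 1 = phi.
Proof. by apply/lfunP => m; rewrite right_multE; case: modM => _ _ -> _. Qed.

(** Multiply phi0 by a monomial x^g of maximal degree that does not annihilate it:
one more x_i gives zero, by maximality or because x_i^ell = 0. *)
Lemma killed_functional (phi0 : 'Hom(M, k^o)) : phi0 != 0 ->
  exists2 phi, phi != 0 & forall i, right_mult phi (x i) = 0.
Proof.
move=> p0.
pose P (g : box n ell) := right_mult phi0 (mon (fun i => g i) 0) != 0.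
pose g0 : box n ell := [ffun=> Ordinal ell0].
have Pg0 : P g0.
  rewrite /P mon0 => [|i]; last by rewrite ffunE.
  by rewrite Kprod0 right_mult1.
have [g Pg gmax] := @arg_maxnP _ g0 P (fun h : box n ell => mdeg (fun i => h i)) Pg0.
exists (right_mult phi0 (mon (fun i => g i) 0)) => // i.
rewrite right_multM (mon_x A prim) right_multZ.
have [d d0 ->] := x_mon A prim i (fun i => g i) 0.
rewrite right_multZ; suff -> : right_mult phi0 (mon (incr (fun i => g i) i) 0) = 0.
  by rewrite !scaler0.
set g' := incr _ _.
case: (boolP [forall j, g' j < ell]%N) => [/forallP bg|]; last first.
  rewrite negb_forall => /existsP[j]; rewrite -leqNgt => lj.
  by rewrite (mon_nil A _ lj) right_mult0.
apply/eqP; apply: contraT => ne.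
have eg : (fun j => box_nat prim g' j : nat) =1 g' by move=> j; rewrite box_natE.
have := gmax (box_nat prim g'); rewrite /P (eq_mon _ _ eg) ne => /(_ isT).
by rewrite (eq_mdeg eg) mdeg_incr /geq /= ltnn.
Qed.

Lemma prod_K_eq0 i : \prod_(t < ell) (K i - (q ^+ t)%:A) = 0.
Proof.
have := congr1 (horner_alg (K i)) (factor_Xn_sub_1 prim).
rewrite rmorph_prod rmorphB rmorphXn rmorph1 /= horner_algX taftK_order subrr => <-.
rewrite big_mkord; apply: eq_bigr => t _.
by rewrite rmorphB /= horner_algX horner_algC.
Qed.

Definition partial_prod i m : A := \prod_(t < m) (K i - (q ^+ t)%:A).

Lemma partial_prodS i m : partial_prod i m.+1 = partial_prod i m * (K i - (q ^+ m)%:A).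
Proof. by rewrite /partial_prod big_ord_recr. Qed.

Lemma partial_prod_K i j m : partial_prod i m * K j = K j * partial_prod i m.
Proof.
elim: m => [|m IH]; first by rewrite /partial_prod big_ord0 mul1r mulr1.
rewrite partial_prodS -mulrA.
have -> : (K i - (q ^+ m)%:A) * K j = K j * (K i - (q ^+ m)%:A).
  by rewrite mulrBl mulrBr taftK_comm -scalerAl -scalerAr mul1r mulr1.
by rewrite !mulrA IH.
Qed.

Lemma partial_prod_x i j m : exists y, partial_prod i m * x j = x j * y.
Proof.
elim: m => [|m [y IH]]; first by exists 1; rewrite /partial_prod big_ord0 mul1r mulr1.
exists (y * (q ^ (alt i j + ((i == j) : nat)%:Z) *: K i - (q ^+ m)%:A)).
rewrite partial_prodS -mulrA.
have -> : (K i - (q ^+ m)%:A) * x j =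
   x j * (q ^ (alt i j + ((i == j) : nat)%:Z) *: K i - (q ^+ m)%:A).
  by rewrite mulrBl mulrBr (taftKx A prim) -scalerAl -!scalerAr mul1r mulr1.
by rewrite mulrA IH mulrA.
Qed.

(** The product of the K - q^t over all t < ell is K^ell - 1 = 0; the last partial
product that does not annihilate phi gives an eigenvector.  It preserves the
conditions already obtained, because partial products commute with the K_j and
can be moved to the right of the x_j. *)
Lemma weight_functional_step m (phi : 'Hom(M, k^o)) (a : 'I_n -> nat) (mn : (m < n)%N) :
  phi != 0 -> (forall i, right_mult phi (x i) = 0) ->
  (forall i, (i < m)%N -> right_mult phi (K i) = q ^+ a i *: phi) ->
  exists psi : 'Hom(M, k^o), exists2 t, (t < ell)%N &
    [/\ psi != 0, forall i, right_mult psi (x i) = 0,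
       forall i, (i < m)%N -> right_mult psi (K i) = q ^+ a i *: psi
     & right_mult psi (K (Ordinal mn)) = q ^+ t *: psi].
Proof.
move=> p0 px pK; set i0 := Ordinal mn.
pose psi t := right_mult phi (partial_prod i0 t).
have [t lt [pt pt1]] : exists2 t, (t < ell)%N & psi t != 0 /\ psi t.+1 = 0.
  have pl : psi ell = 0 by rewrite /psi /partial_prod prod_K_eq0 right_mult0.
  have pz : psi 0%N != 0 by rewrite /psi /partial_prod big_ord0 right_mult1.
  have ex : exists t, psi t == 0 by exists ell; rewrite pl.
  case: (ex_minnP ex) => [[|t] /eqP e tmin]; first by rewrite e eqxx in pz.
  exists t; first by apply: tmin; rewrite pl.
  by split=> //; apply/negP => /tmin; rewrite ltnn.
exists (psi t), t => //; split=> //.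
- move=> i; rewrite right_multM; have [y ->] := partial_prod_x i0 i t.
  by rewrite -right_multM px; apply/lfunP => u; rewrite right_multE !zero_lfunE.
- move=> i im; rewrite right_multM partial_prod_K -right_multM pK //.
  by apply/lfunP => u; rewrite right_multE !scale_lfunE right_multE.
move/eqP: pt1; rewrite /psi partial_prodS -right_multM right_multB right_multZ right_mult1.
by rewrite subr_eq0 => /eqP.
Qed.

Lemma weight_functional : (exists m : M, m != 0) ->
  exists (phi : 'Hom(M, k^o)) (al : lattice n), [/\ in_box ell al, phi != 0,
    forall i m, (phi (actM (eps (x) K i) m) : k) = q ^ al i * (phi m : k)
  & forall i m, phi (actM (eps (x) x i) m) = 0].
Proof.
case=> m0 m0n.
have [phi0 phi0n] : exists phi0 : 'Hom(M, k^o), phi0 != 0.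
  have /existsP[i hi] : [exists i, bcovec i m0 != 0].
    apply: contraNT m0n; rewrite negb_exists => /forallP e.
    rewrite (bvec_expand m0) big1 // => i _.
    by have := e i; rewrite negbK bcovecE => /eqP->; rewrite scale0r.
  by exists (bcovec i); apply: contraNneq hi => ->; rewrite zero_lfunE.
have [phi1 p1 p1x] := killed_functional phi0n.
have [phi [a [al p0 px pK]]] : exists (phi : 'Hom(M, k^o)) (a : 'I_n -> nat),
    [/\ forall i, (a i < ell)%N, phi != 0, forall i, right_mult phi (x i) = 0
      & forall i, (i < n)%N -> right_mult phi (K i) = q ^+ a i *: phi].
  suff: forall m, (m <= n)%N -> exists (phi : 'Hom(M, k^o)) (a : 'I_n -> nat),
    [/\ forall i, (a i < ell)%N, phi != 0, forall i, right_mult phi (x i) = 0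
      & forall i, (i < m)%N -> right_mult phi (K i) = q ^+ a i *: phi] by apply.
  elim=> [_|m IH mn]; first by exists phi1, (fun=> 0%N); split.
  have [phi [a [al p0 px pK]]] := IH (ltnW mn).
  have [psi [t tl [s0 sx sK st]]] := weight_functional_step mn p0 px pK.
  exists psi, (fun i => if i == m :> nat then t else a i); split=> //.
    by move=> i; case: eqP.
  move=> i; rewrite ltnS leq_eqVlt; case: eqP => [e _|ne /= im]; last exact: sK.
  by have -> : i = Ordinal mn by exact: val_inj.
exists phi, (ofnat a); split=> //.
- by move=> i; rewrite ffunE; have := al i; lia.
- move=> i m; have := congr1 (fun f : 'Hom(M, k^o) => f m : k) (pK i (ltn_ord i)).
  by rewrite right_multE scale_lfunE ffunE.
move=> i m; have := congr1 (fun f : 'Hom(M, k^o) => f m : k) (px i).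
by rewrite right_multE zero_lfunE.
Qed.

End WeightFunctional.

(** * Self-dual modules of the Taft algebra *)
Section SelfDualTaft.
Variables (k : fieldType) (n ell : nat) (q : k) (A : taft_algebra n ell q).
Hypothesis prim : ell.-primitive_root q.
Implicit Types (i j : 'I_n) (g : 'I_n -> nat) (a b al be r : lattice n).

Local Notation K := (@taftK k n ell q A).
Local Notation x := (@taftx k n ell q A).
Local Notation mon := (taft_mon A).
Local Notation Kp := (Kprod K).
Local Notation chi al := (taft_char A al).

Let q0 : q != 0 := prim_neq0 prim.
Let ell0 : (0 < ell)%N := prim_order_gt0 prim.
Let gen : skew_generated K x := taft_skew_generated A prim.
Let chiP al := taft_is_character A prim al.
Let KK b := taftK_group_like A prim b.

Lemma taft_char_Kprod al b : chi al (Kp b) = q ^ pairing al b.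
Proof.
rewrite -(mon0 A b (g := fun=> 0%N)) // taft_charE //.
by have -> : [forall i : 'I_n, 0%N == 0%N] by apply/forallP.
Qed.

(** With p zero on multiples of the x_i, only the term x^g K(b) (x) K(b) of the
coproduct of x^g K(b) survives. *)
Lemma rslice_diag (p : hdual A) g b : (forall i h, p (x i * h) = 0) ->
  rslice p (mon g b) = (p (Kp b) : k) *: mon g b.
Proof.
move=> px; rewrite /(mon _ _); elim: (index_enum _) => [|j s IH].
  by rewrite big_nil mul1r (rslice_gl (KK b)).
rewrite big_cons -mulrA; set y := _ * Kp b; rewrite -/y in IH.
have pz u : rslice (pull_l p (x j)) u = 0.
  rewrite rsliceE /sweedler big1 // => s1 _; rewrite big1 // => s2 _.
  by rewrite pull_lE px scale0r scaler0.
elim: (g j) => [|m IHm]; first by rewrite !mul1r.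
rewrite exprS -mulrA (rsliceSl _ _ (sg_comulx gen j)) IHm pz mulr0 addr0.
by rewrite -scalerAr.
Qed.

Lemma dual_char_x al i h : dual_antipodeV (chi al) (x i * h) = 0.
Proof.
rewrite dual_antipodeVE (antipodeVM gen) (antipodeV_x gen) mulrN linearN /= mulrA.
move: (antipodeV A h) => {h}; apply: (mon_ind prim) => [c u v hu hv|g b bg].
  by rewrite !mulrDl -!scalerAl linearP /= opprD -scalerN hu hv scaler0 addr0.
rewrite (mon_x A prim) -scalerAl linearZ /= -mulrA.
by have [_ _ ->] := chiP al; rewrite scaler0 oppr0.
Qed.

Section Simple.
Variables al be : lattice n.
Local Notation v := (wvec A be (kapn ell al be)).
Local Notation act := (twist_act (chi al)).

Lemma top_mem : v \in taft_simple A al be.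
Proof. by apply: (wvec_cyclic A prim) => i; exact: leqnn. Qed.

Lemma kapn_bounded : bounded ell (kapn ell al be).
Proof. by move=> i; exact: (kapn_lt prim). Qed.

Lemma top_x i : act (x i) v = 0.
Proof.
have [d _ ->] := act_x_wvec A prim al be i (kapn ell al be).
have /eqP -> : xcoef q al be (kapn ell al be) i == 0.
  by rewrite (xcoef_eq0 prim) ?eqxx //; exact: kapn_bounded.
by rewrite mul0r scale0r.
Qed.

Lemma ofnat_kapn : ofnat (kapn ell al be) = kappa ell al be.
Proof. by apply/ffunP => i; rewrite ffunE (kapnE prim). Qed.

Lemma top_K i : act (K i) v = q ^ (al i + tilde (kappa ell al be) i) *: v.
Proof. by rewrite (act_K_wvec A prim) ofnat_kapn. Qed.

Let kpair : box n ell * box n ell :=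
  (box_nat prim (kapn ell al be), box_int prim (be - kappa ell al be)).

Lemma top_bmon : v = bmon A kpair.
Proof. by rewrite /wvec (mon_box A prim) ?ofnat_kapn //; exact: kapn_bounded. Qed.

Lemma top_neq0 : v != 0.
Proof.
apply/eqP => e; have := coord_fun_bmon A kpair kpair.
by rewrite -top_bmon e linear0 eqxx => /eqP; rewrite eq_sym oner_eq0.
Qed.

(** Characters of H separate the H^*-weights, which are be on K(be) and be - kappa
on the top vector; in a self-dual module these are opposite. *)
Lemma self_dual_kappa : self_dual (taft_simple_act A al be) ->
  forall i, (kappa ell al be i = be i *+ 2 %[mod ell])%Z.
Proof.
move=> sd i; apply/eqP.
have key := self_dual_weight gen (chiP al) (KK be) top_mem top_x top_K top_neq0 sd.
have {key} : chi (Defs.eps i) (Kp be) = q ^ pairing (Defs.eps i) (kappa ell al be - be) :> k.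
  apply: key; rewrite /wvec (rslice_diag _ _ (@dual_char_x _)); congr (_ *: _).
  rewrite dual_antipodeVE (antipodeV_Kprod A prim) taft_char_Kprod opprB.
  by rewrite ofnat_kapn.
rewrite taft_char_Kprod => /eqP; rewrite (prim_exprz_eq prim).
have pE b : pairing (Defs.eps i) b = b i.
  rewrite -[RHS](sum_delta b i); apply: eq_bigr => j _.
  by rewrite ffunE mulrC eq_sym.
rewrite !pE eq_sym !eqz_mod_dvd; congr (_ %| _)%Z.
by rewrite !ffunE mulr2n; ring.
Qed.

(** The top vector is extremal, and slicing it along its own coordinate gives
K(be - kappa), whose inverse is K(be) when kappa = 2 be. *)
Lemma self_dual_of_kappa :
  (forall i, (kappa ell al be i = be i *+ 2 %[mod ell])%Z) ->
  al = residue ell (- tilde be) -> self_dual (taft_simple_act A al be).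
Proof.
move=> ke ale.
have cd i : q ^ al i * q ^ (al i + tilde (kappa ell al be) i) = 1.
  rewrite -expfzDr //; apply/eqP; rewrite (prim_exprz_eq1 prim).
  have : (tilde (kappa ell al be) i = tilde (be *+ 2) i %[mod ell])%Z.
    by apply: tilde_mod => j; rewrite ke mulr2n ffunE -mulr2n.
  move/eqP; rewrite eqz_mod_dvd => d1.
  have : (al i = - tilde be i %[mod ell])%Z by rewrite ale !ffunE modz_mod.
  move/eqP; rewrite eqz_mod_dvd => d2.
  have -> : al i + (al i + tilde (kappa ell al be) i) =
      (al i - - tilde be i) + (al i - - tilde be i)
      + (tilde (kappa ell al be) i - tilde (be *+ 2) i).
    have -> : tilde (be *+ 2) i = tilde be i + tilde be i.
      have -> : be *+ 2 = be - (- be) by rewrite opprK mulr2n.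
      by rewrite tildeB tildeN opprK.
    by ring.
  by apply: rpredD; first apply: rpredD.
apply: (extremal_self_dual gen (chiP al) (KK be) top_mem top_x top_K cd (f0 := coord_fun A kpair)).
have low g' b' : (mdeg g' < mdeg (kapn ell al be))%N -> coord_fun A kpair (mon g' b') = 0.
  move=> lt; apply: (coord_fun_low A prim).
  have -> // : mdeg (fun i => kpair.1 i) = mdeg (kapn ell al be).
  by apply: eq_mdeg => i; rewrite box_natE //; exact: kapn_bounded.
rewrite /dual_coind; have [_ ->] := slice_top prim (be - ofnat (kapn ell al be)) low.
have -> : mon (kapn ell al be) (be - ofnat (kapn ell al be)) = bmon A kpair by exact: top_bmon.
rewrite (coord_fun_bmon A) eqxx scale1r (antipodeV_Kprod A prim) ofnat_kapn.
rewrite -[RHS]Kprod_residue -[LHS]Kprod_residue; congr (Kprod _ _).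
apply/eqP/residueP => i; apply/eqP; rewrite eqz_mod_dvd.
have := ke i => /eqP; rewrite eqz_mod_dvd; congr (_ %| _)%Z.
by rewrite !mulr2n opprB !ffunE; ring.
Qed.

Lemma self_dual_taft : in_box ell al ->
  self_dual (taft_simple_act A al be) <-> al = residue ell (- tilde be).
Proof.
move=> bal; split=> [/self_dual_kappa e|e]; first exact/kappa_doubleP.
by apply: self_dual_of_kappa => //; apply/kappa_doubleP.
Qed.

End Simple.

(** By [cyclic_iso_inv] K(be) lies in both modules; but the only basis vector v_g
without x-part is K(be'). *)
Lemma taft_simple_inj al be al' be' :
  in_box ell al -> in_box ell be -> in_box ell al' -> in_box ell be' ->
  double_iso (taft_simple_act A al be) (taft_simple_act A al' be') ->
  al = al' /\ be = be'.
Proof.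
move=> bal bbe bal' bbe' iso.
have Kb i : K i * Kp be = Kp be * K i by rewrite -!Kprod_eps KprodC.
have [Vb cc] := cyclic_iso_inv gen (chiP al) (chiP al') (KK be) (KK be') (Kprod_neq0 A be) Kb iso.
split.
  rewrite -[LHS](residue_box bal) -[RHS](residue_box bal'); apply/eqP/residueP => i.
  by apply/eqP; rewrite -(prim_exprz_eq prim) cc.
rewrite -[LHS](residue_box bbe) -[RHS](residue_box bbe').
pose p0 : box n ell := box_nat prim (fun=> 0%N).
have b0 : bounded ell (fun _ : 'I_n => 0%N) by move=> i; exact: ell0.
have KbE b : Kp b = bmon A (p0, box_int prim b) by rewrite -(mon_box A prim) // mon0.
have {}Vb : Kp be \in taft_simple A al' be' := Vb.
rewrite (cyclic_wbasis A prim) in Vb.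
pose f := coord_fun A (p0, box_int prim be).
apply/eqP; apply: contraT => ne.
suff : (<<wbasis A al' be'>> <= lker f)%VS.
  move/subvP/(_ _ Vb); rewrite memv_ker KbE /f coord_fun_bmon eqxx.
  by rewrite (oner_eq0 k).
apply/span_subvP => u /mapP[g _ ->]; rewrite memv_ker /f /wbox /wvec.
rewrite (mon_box A prim) => [|i]; last exact: ltn_ord.
rewrite coord_fun_bmon; case: ((p0, box_int prim be) =P _) => [[eg eb]|//].
case/eqP: ne; rewrite -!(box_intE prim) eb; congr (box_val (box_int _ _)).
apply/ffunP => i; rewrite !ffunE.
have := congr1 (fun h : box n ell => h i : nat) eg; rewrite !ffunE /= mod0n modn_small //.
by move=> <-; rewrite subr0.
Qed.

(** A weight functional coinduces an embedding of M into the twisted comodule H,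
whose image contains some K(be). *)
Lemma taft_simple_exhaust (M : vectType k) (act : drinfeld_double A -> M -> M) :
  is_double_module act -> is_irreducible act ->
  exists al be, [/\ in_box ell al, in_box ell be & double_iso act (taft_simple_act A al be)].
Proof.
move=> modM irr; have [phi [al [bal p0 pK px]]] := weight_functional prim modM irr.1.
pose f := coind_map act phi.
have fL := coind_map_morph gen (chiP al) modM pK px.
have fp := coind_map_p gen modM phi.
have W0 : limg f != 0%VS.
  apply: contraNneq p0 => e; apply/eqP/lfunP => m; rewrite zero_lfunE.
  rewrite -(counit_coind_map modM phi); have := memv_img f (memvf m).
  by rewrite e memv0 => /eqP->; rewrite linear0.
have [p w /memv_imgP[m _ ->]|be bbe /memv_imgP[m0 _ fm0]] := coideal_group_like prim W0.
  by rewrite -fp memv_img ?memvf.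
exists al, be; split=> //.
exact: (irreducible_cyclic gen (chiP al) (KK be) modM irr fL (esym fm0) (Kprod_neq0 A be)).
Qed.

End SelfDualTaft.


Theorem theorem5p3 (k : closedFieldType) (n ell : nat) (q : k)
    (A : taft_algebra n ell q) :
  [pchar k] =i pred0 -> (0 < n)%N -> odd ell -> ell.-primitive_root q ->
  let i0 := (ell.+1)./2 in
  let from_tuple (r al be : lattice n) :=
    [/\ in_box ell r, be = residue ell (r *+ i0)
      & al = residue ell (- tilde be)] in
  let has_kappa (M : vectType k) (act : drinfeld_double A -> M -> M) (r : lattice n) :=
    exists al be : lattice n,
      [/\ in_box ell al, in_box ell be,
          double_iso act (taft_simple_act A al be)
        & kappa ell al be = r] in
  [/\ forall al be : lattice n, in_box ell al -> in_box ell be ->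
        self_dual (taft_simple_act A al be) <->
        exists! r, from_tuple r al be,
      forall al be r : lattice n, in_box ell al -> in_box ell be ->
        from_tuple r al be ->
        \dim (taft_simple A al be) = (\prod_(i < n) (`|r i| + 1))%N /\
        kappa ell al be = r,
      forall (M : vectType k) (act : drinfeld_double A -> M -> M),
        is_double_module act -> is_irreducible act -> self_dual act ->
        exists! r, in_box ell r /\ has_kappa M act r
    & forall (M M' : vectType k) (act : drinfeld_double A -> M -> M)
             (act' : drinfeld_double A -> M' -> M') (r : lattice n),
        is_double_module act -> is_irreducible act -> self_dual act ->
        is_double_module act' -> is_irreducible act' -> self_dual act' ->
        has_kappa M act r -> has_kappa M' act' r ->
        double_iso act act'].
Proof.
move=> _ _ odd_ell prim i0 from_tuple has_kappa.
have ell0 := prim_order_gt0 prim.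
have kappaE (al be : lattice n) : in_box ell al -> al = residue ell (- tilde be) ->
    kappa ell al be = residue ell (be *+ 2).
  move=> bal /(kappa_doubleP be bal) e.
  apply/ffunP => i.
  have kr := residue_box (residue_in_box (- tilde be + be *+ 2 - al) ell0).
  rewrite -[LHS](congr1 (fun f : lattice n => f i) kr).
  by rewrite ffunE e ffunE mulr2n ffunE -mulr2n.
have halfE (be : lattice n) : in_box ell be ->
    be = residue ell (residue ell (be *+ 2) *+ i0).
  move=> bbe; rewrite -[LHS](residue_box bbe); apply/eqP/residueP => i.
  rewrite lattice_mulrn ffunE modzMml -lattice_mulrn -mulrnA mulnC mulrnA.
  by rewrite mulr2n ffunE -mulr2n double_half.
have tupleE (r al be : lattice n) : in_box ell al -> from_tuple r al be -> kappa ell al be = r.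
  move=> bal [br ber ale]; rewrite kappaE // -[RHS](residue_box br).
  apply/eqP/residueP => i; rewrite mulr2n ffunE -mulr2n -(double_half r i odd_ell).
  rewrite ber ffunE !mulr2n; apply/eqP; rewrite eqz_mod_dvd.
  set t := (r *+ _) i; have := divz_eq t ell%:Z; set u := (t %% _)%Z => e.
  have -> : u = t - (t %/ ell%:Z)%Z * ell%:Z by rewrite [X in _ = X - _]e addrC addKr.
  have -> : t - (t %/ ell%:Z)%Z * ell%:Z + (t - (t %/ ell%:Z)%Z * ell%:Z) - (t + t) =
    (- (t %/ ell%:Z)%Z *+ 2) * ell%:Z by ring.
  exact: dvdz_mull.
have sdP (al be : lattice n) : in_box ell al -> in_box ell be ->
    self_dual (taft_simple_act A al be) -> from_tuple (kappa ell al be) al be.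
  move=> bal bbe /(self_dual_taft A prim be bal) ale.
  split=> //; first exact: residue_in_box.
  by rewrite kappaE // -halfE.
have sd_label (M : vectType k) (act : drinfeld_double A -> M -> M) r :
    is_double_module act -> self_dual act -> has_kappa M act r ->
    exists al be, [/\ in_box ell al, from_tuple r al be
      & double_iso act (taft_simple_act A al be)].
  move=> modM sdM [al [be [bal bbe iso kr]]]; exists al, be; split=> //.
  rewrite -kr; apply: sdP => //; apply: self_dual_iso iso sdM.
    exact: module_act_linear.
  exact: cyclic_act_is_linear_r.
split.
- move=> al be bal bbe; split=> [sd|[r [[br ber ale] _]]].
    exists (kappa ell al be); split; first exact: sdP.
    by move=> r fr; exact: tupleE.
  exact/(self_dual_taft A prim be bal).
- move=> al be r bal bbe fr; have kr := tupleE _ _ _ bal fr; split=> //.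
  by rewrite (dim_taft_simple A prim) -kr.
- move=> M act modM irr sdM.
  have [al [be [bal bbe iso]]] := taft_simple_exhaust prim modM irr.
  exists (kappa ell al be); split.
    by split; [exact: (residue_in_box _ ell0) | exists al, be].
  move=> r [_ [al' [be' [bal' bbe' iso' <-]]]].
  have := double_iso_trans (double_iso_sym iso) iso'.
  by case/(taft_simple_inj prim bal bbe bal' bbe') => <- <-.
move=> M M' act act' r modM _ sdM modM' _ sdM' kM kM'.
have [al [be [_ [_ ber ale] iso]]] := sd_label _ _ _ modM sdM kM.
have [al' [be' [_ [_ ber' ale'] iso']]] := sd_label _ _ _ modM' sdM' kM'.
have eb : be' = be by rewrite ber' -ber.
have ea : al' = al by rewrite ale' eb -ale.
by rewrite eb ea in iso'; exact: double_iso_trans iso (double_iso_sym iso').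
Qed.
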